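(* Let $G$ be a $2$-edge-connected graph and $\emptyset\subsetneq S\subsetneq V(G)$ such that $\delta(S)$ is an inclusion-wise minimal cut with $|\delta(S)|\ge 3$. Let $e\in\delta(S)$. Then the asymmetric cut inequality $$x_e - x(\delta(S)\setminus\{e\})\le 0$$ defines a facet of $\mathrm{TECSP}(G)$ if and only if every bridge of $G[S]$ and every bridge of $G[V(G)\setminus S]$ lies in a common coparallel class of $G$ with some edge of $\delta(S)$.
   Context: All graphs are finite, simple and undirected. For $\emptyset\subsetneq S\subsetneq V(G)$, $\delta(S)$ is the set of edges with exactly one endpoint in $S$ (a cut); $G[S]$ is the induced subgraph on $S$. An edge $e$ is a bridge of a graph if its removal increases the number of connected components. A graph is $2$-edge-connected if it is connected and has no bridges; the empty graph and a single vertex are $2$-edge-connected. For $F\subseteq E(G)$, $x(F)=\sum_{f\in F}x_f$. $\chi^H\in\{0,1\}^{E(G)}$ is the incidence vector of $E(H)$, and $\mathrm{TECSP}(G)=\mathrm{conv}\{\chi^H : H\subseteq G\text{ is }2\text{-edge-connected}\}\subseteq\mathbb{R}^{E(G)}$. Two distinct edges $e,f$ of $G$ are coparallel if $\{e,f\}$ is an inclusion-wise minimal cut of $G$; a coparallel class is an inclusion-wise maximal set of non-bridge edges of $G$ any two distinct elements of which are coparallel (a non-bridge edge in no $2$-cut forms a singleton class). A facet is a face of dimension $\dim(\mathrm{TECSP}(G))-1$. *)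

(* Defs.v *)
From HB Require Import structures.
From mathcomp Require Import all_boot all_order all_algebra.
Set Implicit Arguments. Unset Strict Implicit. Unset Printing Implicit Defensive.
Import Order.TTheory GRing.Theory Num.Theory.
Local Open Scope ring_scope.

(* A finite simple graph on vertex type V is given by a symmetric,
   irreflexive relation g.  An edge is the 2-element vertex set {u,v}. *)
Section Graphs.
Variable V : finType.

Definition gedges (g : rel V) : {set {set V}} :=
  [set f : {set V} | [exists u : V, exists v : V, g u v && (f == [set u; v])]].

Definition fadj (F : {set {set V}}) : rel V :=
  fun u v => (u != v) && ([set u; v] \in F).

Definition ncomp (W : {set V}) (F : {set {set V}}) : nat :=
  n_comp (connect (fadj F)) (mem W).

Definition is_graph (W : {set V}) (F : {set {set V}}) : Prop :=
  forall f, f \in F -> f \subset W /\ #|f| = 2.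

Definition gconnected (W : {set V}) (F : {set {set V}}) : Prop :=
  forall u v, u \in W -> v \in W -> connect (fadj F) u v.

Definition is_bridge (W : {set V}) (F : {set {set V}}) (f : {set V}) : Prop :=
  f \in F /\ (ncomp W F < ncomp W (F :\ f))%N.

Definition two_ec (W : {set V}) (F : {set {set V}}) : Prop :=
  gconnected W F /\ forall f, ~ is_bridge W F f.

Definition subgraph (g : rel V) (W : {set V}) (F : {set {set V}}) : Prop :=
  is_graph W F /\ F \subset gedges g.

Definition induced_edges (g : rel V) (S : {set V}) : {set {set V}} :=
  [set f in gedges g | f \subset S].

Definition delta (g : rel V) (S : {set V}) : {set {set V}} :=
  [set f in gedges g | (f :&: S != set0) && (f :\: S != set0)].

Definition proper_vset (S : {set V}) : Prop := S != set0 /\ S != setT.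

Definition is_cut (g : rel V) (C : {set {set V}}) : Prop :=
  exists S, proper_vset S /\ C = delta g S.

Definition is_min_cut (g : rel V) (C : {set {set V}}) : Prop :=
  is_cut g C /\ forall C', is_cut g C' -> ~ (C' \proper C).

Definition coparallel (g : rel V) (e f : {set V}) : Prop :=
  e != f /\ is_min_cut g [set e; f].

Definition copar_family (g : rel V) (K : {set {set V}}) : Prop :=
  K \subset gedges g /\
  (forall f, f \in K -> ~ is_bridge setT (gedges g) f) /\
  (forall f h, f \in K -> h \in K -> f != h -> coparallel g f h).

Definition copar_class (g : rel V) (K : {set {set V}}) : Prop :=
  copar_family g K /\ forall K', copar_family g K' -> ~ (K \proper K').

End Graphs.

(* Polyhedral notions in R^E, where coordinates are indexed by T
   (we use T = {set V}; coordinates outside E(G) are identically zero on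
   the polytope, which does not affect affine dimensions). *)
Section Poly.
Variables (R : realFieldType) (T : finType).
Notation vec := {ffun T -> R}.

Definition dotv (a x : vec) : R := \sum_t a t * x t.

Definition aff_indep (k : nat) (p : 'I_k.+1 -> vec) : Prop :=
  forall c : 'I_k.+1 -> R,
    (forall t, \sum_i c i * p i t = 0) -> \sum_i c i = 0 -> forall i, c i = 0.

Definition has_dim (P : vec -> Prop) (d : nat) : Prop :=
  (exists p : 'I_d.+1 -> vec, (forall i, P (p i)) /\ aff_indep p) /\
  ~ (exists p : 'I_d.+2 -> vec, (forall i, P (p i)) /\ aff_indep p).

Definition defines_facet (P : vec -> Prop) (a : vec) (b : R) : Prop :=
  (forall x, P x -> dotv a x <= b) /\
  exists d : nat, has_dim P d.+1 /\ has_dim (fun x => P x /\ dotv a x = b) d.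

Definition conv_hull (I : finType) (X : I -> Prop) (pt : I -> vec) (x : vec)
  : Prop :=
  exists lam : I -> R,
    (forall i, 0 <= lam i) /\ (forall i, ~ X i -> lam i = 0) /\
    \sum_i lam i = 1 /\ forall t, x t = \sum_i lam i * pt i t.
End Poly.

Definition chi (R : realFieldType) (V : finType) (F : {set {set V}})
  : {ffun {set V} -> R} := [ffun f => if f \in F then 1 else 0].

Definition TECSP (R : realFieldType) (V : finType) (g : rel V)
  : {ffun {set V} -> R} -> Prop :=
  conv_hull (fun F : {set {set V}} =>
               exists W : {set V}, subgraph g W F /\ two_ec W F)
            (@chi R V).

Definition asym_cut_coef (R : realFieldType) (V : finType) (g : rel V)
  (S : {set V}) (e : {set V}) : {ffun {set V} -> R} :=
  [ffun f => if f == e then 1 else if f \in delta g S then -1 else 0].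

(* Main.v *)
Require Import Defs.
From HB Require Import structures.
From mathcomp Require Import all_boot all_order all_algebra.
From mathcomp Require Import ring lra.
Set Implicit Arguments. Unset Strict Implicit. Unset Printing Implicit Defensive.
Import Order.TTheory GRing.Theory Num.Theory.
Local Open Scope ring_scope.

(** Everything is phrased through cuts [cut F X] of edge sets, which add up modulo
    2: the cut of a symmetric difference of vertex sets is the symmetric
    difference of their cuts.  Since [0] is a vertex of the polytope and of the
    face, the inequality [a x <= 0] defines a facet iff it is not an equation and
    every functional vanishing on the 2-edge-connected subgraphs of the face is a
    multiple of [a] on all 2-edge-connected subgraphs.

    Deleting the bridges of any edge set [F] leaves a disjoint union of
    2-edge-connected graphs, so a functional vanishing on the 2-edge-connected
    subgraphs of [F] vanishes on every coparallel class of [F].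

    Sufficiency: let [phi] vanish on the face, and for [h <> e] in the cut let
    [G_h] be [G] without the cut edges other than [e] and [h]; then [phi] vanishes
    on all classes of [G_h].  The class of [e] in [G_h] is the union of the
    classes of [e] and [h] in [G], so these get opposite values.  A class [K] of
    [G] missing the cut lies on one side, say in [S]; the larger class [D] of
    [G[S]] containing it is cyclically arranged, and [D \ K] splits into at most
    two sets of the form [D \ L], with [L] a class of some [G_h].

    Necessity: a bridge [b] of [G[S]] splits [S]; if [X] is the part not touching
    [e], then [x_b = x(cut X \ b)] holds on the face, and this equation is
    independent of [a] unless the class of [b] meets the cut. *)

(** * Affine dimension as a rank, and a dual criterion for facets through the origin *)

Section AffineDimension.
Variables (R : realFieldType) (T I : finType).
Notation vec := {ffun T -> R}.
Implicit Types (x c a : vec) (P : vec -> Prop) (Q : pred I).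

Definition row_of_vec x : 'rV[R]_#|T| := \row_j x (enum_val j).

Lemma dotvE a x : dotv a x = (row_of_vec x *m (row_of_vec a)^T) 0 0.
Proof.
rewrite mxE /dotv (big_enum_val (A := T)) /=.
by apply: eq_bigr => j _; rewrite !mxE mulrC.
Qed.

Lemma row_of_vec_ffun (u : 'rV[R]_#|T|) :
  row_of_vec [ffun t => u 0 (enum_rank t)] = u.
Proof. by apply/rowP => j; rewrite !mxE ffunE enum_valK. Qed.

(** Points outside [Q] become zero rows, so the row space is the span of the points selected by [Q]
    while rows stay indexed by all of [I]. *)
Definition point_mx Q (pt : I -> vec) : 'M[R]_(#|I|, #|T|) :=
  \matrix_(i < #|I|)
    if Q (enum_val i) then row_of_vec (pt (enum_val i)) else 0.

Lemma row_point_mx Q pt i :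
  row i (point_mx Q pt) =
  if Q (enum_val i) then row_of_vec (pt (enum_val i)) else 0.
Proof. by rewrite rowK. Qed.

Lemma point_mx_sub Q pt i : Q i -> (row_of_vec (pt i) <= point_mx Q pt)%MS.
Proof.
by move=> Qi; apply: (eq_row_sub (enum_rank i)); rewrite row_point_mx enum_rankK Qi.
Qed.

Lemma point_mx_subP m (A : 'M[R]_(m, #|T|)) Q pt :
  (forall i, Q i -> (row_of_vec (pt i) <= A)%MS) -> (point_mx Q pt <= A)%MS.
Proof.
move=> sA; apply/row_subP => i; rewrite row_point_mx.
by case: ifP => [/sA //|_]; rewrite sub0mx.
Qed.

(** As [0] lies in [P], the affine hull of [P] is its linear span. Differences to the first of [k+1]
    affinely independent points are [k] independent rows; conversely [0] and [k] independent rows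
    are affinely independent. *)
Lemma aff_indep_rank P Q pt k :
  P 0 -> (forall i, Q i -> P (pt i)) ->
  (forall x, P x -> (row_of_vec x <= point_mx Q pt)%MS) ->
  (exists p : 'I_k.+1 -> vec, (forall i, P (p i)) /\ aff_indep p) <->
  (k <= \rank (point_mx Q pt))%N.
Proof.
move=> P0 PQ Psub; set M := point_mx Q pt in Psub *; split.
  case=> p [Pp indep].
  pose N : 'M[R]_(k, #|T|) :=
    \matrix_(i < k) (row_of_vec (p (lift ord0 i)) - row_of_vec (p ord0)).
  have sN : (N <= M)%MS.
    apply/row_subP => i; rewrite rowK addmx_sub ?Psub //.
    by rewrite eqmx_opp Psub.
  have fN : row_free N.
    apply: inj_row_free => v vN0.
    pose c i := if unlift ord0 i is Some j then v 0 j else - \sum_j v 0 j.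
    have c0 : c ord0 = - \sum_j v 0 j by rewrite /c unlift_none.
    have cS (j : 'I_k) : c (lift ord0 j) = v 0 j by rewrite /c liftK.
    have sc : \sum_i c i = 0.
      rewrite big_ord_recl c0 addrC; apply/eqP; rewrite subr_eq0; apply/eqP.
      by apply: eq_bigr => j _; rewrite cS.
    have ct t : \sum_i c i * p i t = 0.
      have /rowP/(_ (enum_rank t)) := vN0; rewrite !mxE => vt; rewrite -[RHS]vt.
      rewrite big_ord_recl c0 mulNr mulr_suml addrC -sumrB.
      apply: eq_bigr => j _; rewrite cS !mxE enum_rankK mulrBr; lra.
    by apply/rowP => j; rewrite mxE -cS (indep c ct sc).
  by move: fN; rewrite -row_leq_rank => /leq_trans-> //; apply: mxrankS.
move=> lek.
(* The points are [0] followed by the first [k] rows of a maximal free submatrix. *)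
pose h (j : 'I_k) := maxrankfun M (widen_ord lek j).
pose q (i : I) := if Q i then pt i else 0.
have Pq i : P (q i) by rewrite /q; case: ifP => // /PQ.
pose p (i : 'I_k.+1) := if unlift ord0 i is Some j then q (enum_val (h j)) else 0.
exists p; split; first by move=> i; rewrite /p; case: unliftP.
move=> c ct sc.
have cS j : c (lift ord0 j) = 0.
  (* The coefficients are extended by zero to all rows of the free submatrix. *)
  pose v : 'rV[R]_(\rank M) :=
    \row_i (\sum_(j < k | widen_ord lek j == i) c (lift ord0 j)).
  have v0 : v *m rowsub (maxrankfun M) M = 0.
    apply/rowP => t; rewrite !mxE -[RHS](ct (enum_val t)).
    rewrite big_ord_recl [p ord0]/p unlift_none ffunE mulr0 add0r.
    under eq_bigr => i _ do rewrite !mxE mulr_suml.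
    rewrite (exchange_big_dep xpredT) //=; apply: eq_bigr => l _.
    rewrite (big_pred1 (widen_ord lek l)) => [|i]; last by rewrite eq_sym.
    by rewrite /p liftK /q /h; case: ifP; rewrite ?mxE ?ffunE.
  have := mulmx_free_eq0 v (maxrowsub_free M); rewrite v0 eqxx => /esym/eqP.
  move=> /rowP/(_ (widen_ord lek j)); rewrite !mxE => <-.
  by rewrite (big_pred1 j).
move=> i; case: (unliftP ord0 i) => [j ->|->]; first exact: cS.
by move: sc; rewrite big_ord_recl big1 ?addr0 // => j _; apply: cS.
Qed.

Lemma has_dim_rank P Q pt d :
  P 0 -> (forall i, Q i -> P (pt i)) ->
  (forall x, P x -> (row_of_vec x <= point_mx Q pt)%MS) ->
  has_dim P d <-> \rank (point_mx Q pt) = d.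
Proof.
move=> P0 PQ Psub; rewrite /has_dim.
rewrite (aff_indep_rank d P0 PQ Psub) (aff_indep_rank d.+1 P0 PQ Psub).
split=> [[ge /negP]|<-]; first by rewrite -ltnNge ltnS => le; apply/eqP; rewrite eqn_leq le.
by split=> //; rewrite ltnn.
Qed.

Lemma combination_sub (pt : I -> vec) m (A : 'M[R]_(m, #|T|)) x lam :
  (forall t, x t = \sum_i lam i * pt i t) ->
  (forall i, lam i != 0 -> (row_of_vec (pt i) <= A)%MS) ->
  (row_of_vec x <= A)%MS.
Proof.
move=> xE sA.
have -> : row_of_vec x = \sum_i lam i *: row_of_vec (pt i).
  apply/rowP => j; rewrite mxE xE summxE; apply: eq_bigr => i _.
  by rewrite !mxE.
apply: summx_sub => i _; have [->|/sA] := eqVneq (lam i) 0.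
  by rewrite scale0r sub0mx.
exact: scalemx_sub.
Qed.

Lemma dotv_sum a x (pt : I -> vec) (lam : I -> R) :
  (forall t, x t = \sum_i lam i * pt i t) ->
  dotv a x = \sum_i lam i * dotv a (pt i).
Proof.
move=> xE; rewrite /dotv; under eq_bigr do rewrite xE mulr_sumr.
rewrite exchange_big; apply: eq_bigr => i _; rewrite mulr_sumr.
by apply: eq_bigr => t _; rewrite mulrCA.
Qed.

Lemma conv_hull_pt (X : I -> Prop) (pt : I -> vec) i :
  X i -> conv_hull X pt (pt i).
Proof.
move=> Xi; exists (fun j => (j == i)%:R); split; first by move=> j; rewrite ler0n.
split; first by move=> j nXj; case: eqP => // E; case: nXj; rewrite E.
split=> [|t]; rewrite (bigD1 i) //= eqxx ?mul1r big1 ?addr0 // => j /negPf->//.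
by rewrite mul0r.
Qed.

(** Since [pt i0 = 0] lies on the face, both dimensions are ranks, and a facet means a drop by
    exactly one. Any point off the face raises the rank of the face by one; whether the whole span
    is then reached is tested by the functionals vanishing on the face. *)
Lemma facet_criterion (X : I -> Prop) Q (pt : I -> vec) a i0 :
  (forall i, reflect (X i) (Q i)) -> Q i0 -> pt i0 = 0 ->
  (forall i, Q i -> dotv a (pt i) <= 0) ->
  defines_facet (conv_hull X pt) a 0 <->
  (exists2 i, Q i & dotv a (pt i) != 0) /\
  (forall c, (forall i, Q i -> dotv a (pt i) = 0 -> dotv c (pt i) = 0) ->
     exists lam, forall i, Q i -> dotv c (pt i) = lam * dotv a (pt i)).
Proof.
move=> XQ Qi0 pt0 valid.
pose Q' i := Q i && (dotv a (pt i) == 0).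
pose face x := conv_hull X pt x /\ dotv a x = 0.
have hullP x : conv_hull X pt x -> (row_of_vec x <= point_mx Q pt)%MS.
  case=> lam [_ [lamX [_ xE]]]; apply: (combination_sub xE) => i lami.
  by apply/point_mx_sub/XQ/XQ; apply: contraNT lami => /XQ/lamX->.
have dot0 x : x = 0 -> dotv a x = 0.
  by move=> ->; rewrite /dotv big1 // => t _; rewrite ffunE mulr0.
have hull0 : conv_hull X pt 0 by rewrite -pt0; apply/conv_hull_pt/XQ.
have faceP x : face x -> (row_of_vec x <= point_mx Q' pt)%MS.
  case=> -[lam [lam0 [lamX [_ xE]]]]; rewrite (dotv_sum a xE) => ax.
  have lamQ i : lam i != 0 -> Q i by apply: contraNT => /XQ/lamX->.
  apply: (combination_sub xE) => i lami; apply: point_mx_sub.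
  rewrite /Q' lamQ //=.
  (* A sum of nonpositive terms is zero only if each term is, so a point of the face puts weight
     only on generators in the face. *)
  have /eqP := ax; rewrite -oppr_eq0 -sumrN psumr_eq0; last first.
    move=> j _; rewrite -mulrN; have [->|/lamQ/valid vj] := eqVneq (lam j) 0.
      by rewrite mul0r.
    by rewrite mulr_ge0 ?oppr_ge0.
  move/allP/(_ i (mem_index_enum _)); rewrite implyTb oppr_eq0 mulf_eq0.
  by rewrite (negPf lami).
have face_dim d : has_dim face d <-> \rank (point_mx Q' pt) = d.
  apply: has_dim_rank => //; first by split=> //; apply: dot0.
  by move=> i /andP[/XQ Xi /eqP]; split=> //; apply: conv_hull_pt.
have hull_dim d : has_dim (conv_hull X pt) d <-> \rank (point_mx Q pt) = d.
  by apply: has_dim_rank => // i /XQ; apply: conv_hull_pt.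
have sQ'Q : (point_mx Q' pt <= point_mx Q pt)%MS.
  by apply: point_mx_subP => i /andP[Qi _]; apply: point_mx_sub.
have facetE : defines_facet (conv_hull X pt) a 0 <->
    \rank (point_mx Q pt) = (\rank (point_mx Q' pt)).+1.
  split=> [[_ [d [/hull_dim-> /face_dim->]]] //|rk].
  split; last first.
    exists (\rank (point_mx Q' pt)); split; first exact/hull_dim.
    exact/face_dim.
  move=> x [lam [lam0 [lamX [_ xE]]]]; rewrite (dotv_sum a xE).
  rewrite -oppr_ge0 -sumrN sumr_ge0 // => i _; rewrite -mulrN.
  case: (XQ i) => [/XQ Qi|/lamX->]; last by rewrite mul0r.
  by rewrite mulr_ge0 // oppr_ge0 valid.
have killE c m (A : 'M[R]_(m, #|T|)) x :
    (row_of_vec x <= A)%MS -> A *m (row_of_vec c)^T = 0 -> dotv c x = 0.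
  by case/submxP => D xE A0; rewrite dotvE xE -mulmxA A0 mulmx0 mxE.
have killQ c (P : pred I) : (forall i, P i -> dotv c (pt i) = 0) ->
    point_mx P pt *m (row_of_vec c)^T = 0.
  move=> c0; apply/row_matrixP => i; rewrite row_mul row_point_mx row0.
  case: ifP => [/c0|]; last by rewrite mul0mx.
  by rewrite dotvE => E; apply/rowP => j; rewrite !ord1 E mxE.
have aQ' : point_mx Q' pt *m (row_of_vec a)^T = 0.
  by apply: killQ => i /andP[_ /eqP].
have notface i : dotv a (pt i) != 0 ->
    ~~ (row_of_vec (pt i) <= point_mx Q' pt)%MS.
  by apply: contra => s; rewrite (killE _ _ _ _ s aQ').
have rkU i : dotv a (pt i) != 0 ->
    \rank (point_mx Q' pt + row_of_vec (pt i))%MS = (\rank (point_mx Q' pt)).+1.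
  move=> /notface nf; apply/eqP; rewrite eqn_leq; apply/andP; split.
    apply: leq_trans (mxrank_adds_leqif _ _) _.
    by rewrite -[X in (_ <= X)%N]addn1 leq_add2l rank_leq_row.
  have : (point_mx Q' pt < point_mx Q' pt + row_of_vec (pt i))%MS.
    by rewrite ltmxE addsmxSl /= addsmx_sub submx_refl.
  by move/rank_ltmx.
rewrite facetE; split.
  move=> rk.
  have [i1 Qi1 ai1] : exists2 i, Q i & dotv a (pt i) != 0.
    case: (pickP [pred i | Q i & dotv a (pt i) != 0]) => [i /andP[]|none].
      by exists i.
    have : (point_mx Q pt <= point_mx Q' pt)%MS.
      apply: point_mx_subP => i Qi; apply: point_mx_sub; rewrite /Q' Qi /=.
      by move: (none i); rewrite /= Qi => /negbFE.
    by move/mxrankS; rewrite rk ltnn.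
  split; first by exists i1.
  move=> c cface.
  (* With this multiple [c - lam * a] vanishes at [pt i1] as well as on the face, hence by the rank
     count on all points. *)
  pose lam := dotv c (pt i1) / dotv a (pt i1); exists lam.
  pose c' : vec := [ffun t => c t - lam * a t].
  have c'E x : dotv c' x = dotv c x - lam * dotv a x.
    rewrite /dotv mulr_sumr -sumrB; apply: eq_bigr => t _.
    by rewrite ffunE mulrBl mulrA.
  have U0 : (point_mx Q' pt + row_of_vec (pt i1))%MS *m (row_of_vec c')^T = 0.
    have : (point_mx Q' pt + row_of_vec (pt i1) <= kermx (row_of_vec c')^T)%MS.
      rewrite addsmx_sub; apply/andP; split; apply/sub_kermxP.
        by apply: killQ => i /andP[Qi /eqP ai]; rewrite c'E cface // ai; lra.
      apply/rowP => j; rewrite !ord1 -dotvE c'E mxE /lam; field.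
      exact: ai1.
    by move/sub_kermxP.
  have UQ : (point_mx Q pt <= point_mx Q' pt + row_of_vec (pt i1))%MS.
    have sUQ : (point_mx Q' pt + row_of_vec (pt i1) <= point_mx Q pt)%MS.
      by rewrite addsmx_sub sQ'Q point_mx_sub.
    by have := (mxrank_leqif_sup sUQ).2; rewrite rkU // -rk eqxx.
  move=> i Qi; apply/eqP; rewrite -subr_eq0 -c'E; apply/eqP.
  by apply: (killE _ _ _ _ _ U0); apply: submx_trans UQ; apply: point_mx_sub.
case=> -[i1 Qi1 ai1] crit.
suff UQ : (point_mx Q pt <= point_mx Q' pt + row_of_vec (pt i1))%MS.
  apply/eqP; rewrite -(rkU i1 ai1) eqn_leq mxrankS //=.
  by rewrite mxrankS // addsmx_sub sQ'Q point_mx_sub.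
apply: point_mx_subP => i Qi; rewrite submxE.
set U := (_ + _)%MS; apply/eqP/rowP => j.
(* A column of the cokernel of [U] is a functional vanishing on [U]; it must be a multiple of [a],
   and [pt i1] forces the multiple to be zero. *)
pose c : vec := [ffun t => (col j (cokermx U))^T 0 (enum_rank t)].
have cE x : dotv c x = (row_of_vec x *m cokermx U) 0 j.
  rewrite dotvE row_of_vec_ffun trmxK !mxE.
  by apply: eq_bigr => k _; rewrite !mxE.
have cU x : (row_of_vec x <= U)%MS -> dotv c x = 0.
  by rewrite submxE cE => /eqP->; rewrite mxE.
have [k Qk ak|lam lamE] := crit c.
  apply: cU; apply: submx_trans (addsmxSl _ _); apply: point_mx_sub.
  by rewrite /Q' Qk ak eqxx.
have lam0 : lam = 0.
  have := cU (pt i1) (addsmxSr _ _); rewrite lamE // => /eqP.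
  by rewrite mulf_eq0 (negPf ai1) orbF => /eqP.
by rewrite -cE lamE // lam0 mul0r mxE.
Qed.

End AffineDimension.

(** * Cuts, bridges and connectivity of edge sets *)

Section Cuts.
Variable V : finType.
Implicit Types (f h : {set V}) (X Y W : {set V}) (F E : {set {set V}}).

Definition symd (T : finType) (A B : {set T}) : {set T} :=
  [set x | (x \in A) (+) (x \in B)].

(** Same formula as in [delta], which makes [delta g S] and [cut (gedges g) S] convertible. *)
Definition crosses f X := (f :&: X != set0) && (f :\: X != set0).
Definition cut F X := [set f in F | crosses f X].
Definition simple F := forall f, f \in F -> #|f| = 2%N.
(** Bridges are treated as one-element cuts; connectivity is kept apart in [conn]. *)
Definition bridgeless F := [forall X, #|cut F X| != 1%N].
Definition core F := [set f in F | [forall X, cut F X != [set f]]].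
(* Isolated vertices are ignored: only the endpoints of edges must be connected. *)
Definition conn F :=
  [forall X, (cut F X == set0) ==> ((cover F \subset X) || [disjoint cover F & X])].

Lemma crosses2 u v X : crosses [set u; v] X = (u \in X) (+) (v \in X).
Proof.
apply/andP/idP => [[/set0Pn[x /setIP[/set2P xuv xX]] /set0Pn[y /setDP[/set2P yuv yX]]]|].
  by case: xuv yuv => Ex [] Ey; move: xX yX; rewrite Ex Ey => -> // /negPf->.
case uX: (u \in X); case vX: (v \in X) => //= _; split; apply/set0Pn.
- by exists u; rewrite !inE eqxx uX.
- by exists v; rewrite !inE eqxx vX orbT.
- by exists v; rewrite !inE eqxx vX orbT.
- by exists u; rewrite !inE eqxx uX.
Qed.

Lemma crosses_symd f X Y : #|f| = 2%N ->
  crosses f (symd X Y) = crosses f X (+) crosses f Y.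
Proof.
move=> /eqP/cards2P[u [v [_ ->]]]; rewrite !crosses2 !inE.
by do 4!case: (_ \in _).
Qed.

Lemma crossesC f X : crosses f (~: X) = crosses f X.
Proof. by rewrite /crosses !setDE setCK andbC. Qed.

Lemma in_cut F f X : (f \in cut F X) = (f \in F) && crosses f X.
Proof. by rewrite inE. Qed.

Lemma cutC F X : cut F (~: X) = cut F X.
Proof. by apply/setP => f; rewrite !in_cut crossesC. Qed.

Lemma cut_symd F X Y : simple F -> cut F (symd X Y) = symd (cut F X) (cut F Y).
Proof.
move=> sF; apply/setP => f; rewrite in_cut !inE -!/(crosses _ _).
by case fF: (f \in F); rewrite //= crosses_symd // sF.
Qed.

Lemma simpleS F F' : F' \subset F -> simple F -> simple F'.
Proof. by move=> /subsetP sub sF f /sub/sF. Qed.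

Lemma core_sub F : core F \subset F.
Proof. by apply/subsetP => f /setIdP[]. Qed.

Lemma coreP F f : reflect (f \in F /\ forall X, cut F X <> [set f]) (f \in core F).
Proof.
by apply: (iffP setIdP) => -[fF /= cF]; split=> //;
  [move=> X; apply/eqP; apply: (forallP cF) | apply/forallP => X; apply/eqP].
Qed.

Lemma notcoreP F f : f \in F -> f \notin core F -> exists X, cut F X = [set f].
Proof. by move=> fF; rewrite inE fF /= => /forallPn[X /negPn/eqP]; exists X. Qed.

(** Let [{f}] be a cut of [core F]. The corresponding cut of [F] only adds edges outside the core,
    each of which alone is a cut of [F]; adding these cuts one by one removes them without touching
    the core, until [{f}] is a cut of [F]. *)
Lemma core_bridgeless F : simple F -> bridgeless (core F).
Proof.
move=> sF; apply/forallP => X0; apply/negP => /cards1P[f].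
have [n] := ubnP #|cut F X0 :\: core F|; elim: n X0 => // n IHn X ltn cX.
have fcX : f \in cut (core F) X by rewrite cX set11.
have fX : f \in core F by move: fcX; rewrite in_cut => /andP[].
have [e0|[h]] := set_0Vmem (cut F X :\: core F).
  case/coreP: (fX) => _ /(_ X); apply; rewrite -cX; apply/setP => h.
  rewrite !in_cut; apply/andP/andP => -[hF cr]; split=> //; last first.
    exact: (subsetP (core_sub F)).
  have : h \notin cut F X :\: core F by rewrite e0 inE.
  by rewrite inE in_cut hF cr !andbT negbK.
rewrite inE in_cut => /and3P[hc hF hX].
have [Y cY] := notcoreP hF hc.
have ch x : x \in F -> crosses x Y = (x == h).
  by move=> xF; have /setP/(_ x) := cY; rewrite in_cut xF inE.
apply: (IHn (symd X Y)); last first.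
  rewrite -cX; apply/setP => x; rewrite !in_cut.
  case xc: (x \in core F) => //=.
  have xF := subsetP (core_sub F) x xc.
  rewrite crosses_symd ?sF // ch //; case: eqP => [E|_]; last by rewrite addbF.
  by rewrite -E xc in hc.
rewrite -ltnS; apply: leq_trans ltn; rewrite ltnS; apply: proper_card.
apply/properP; split; last first.
  exists h; first by rewrite inE hc in_cut hF hX.
  by rewrite inE in_cut hF crosses_symd ?sF // hX ch // eqxx andbF.
apply/subsetP => x; rewrite !inE -!/(crosses _ _) => /and3P[-> xF].
rewrite xF crosses_symd ?sF // ch //=.
by case: eqP => [->|_]; rewrite ?addbF // hX.
Qed.

Lemma bridgelessP F X f : bridgeless F -> cut F X <> [set f].
Proof. by move=> /forallP/(_ X) /negP nc E; apply: nc; rewrite E cards1. Qed.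

Lemma bridgeless_core F : bridgeless F -> core F = F.
Proof.
move=> bF; apply/eqP; rewrite eqEsubset core_sub; apply/subsetP => f fF.
by apply/coreP; split=> // X; apply: bridgelessP.
Qed.

Lemma fadj_sym F : symmetric (fadj F).
Proof. by move=> u v; rewrite /fadj eq_sym setUC. Qed.

Lemma cut0_closed F X : cut F X = set0 -> closed (fadj F) X.
Proof.
move=> cX u v /andP[_ uvF]; have := in_set0 [set u; v]; rewrite -cX in_cut uvF.
by rewrite crosses2 /=; case: (u \in X); case: (v \in X).
Qed.

Lemma cut0_connect F X u v :
  cut F X = set0 -> connect (fadj F) u v -> (u \in X) = (v \in X).
Proof. by move=> /cut0_closed cX; apply: (closed_connect cX). Qed.

Lemma cut_component F u : simple F -> cut F [set v | connect (fadj F) u v] = set0.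
Proof.
move=> sF; apply/eqP; rewrite -subset0; apply/subsetP => f; rewrite in_cut.
case/andP => fF; have /eqP/cards2P[x [y [xy fE]]] := sF f fF; rewrite fE crosses2 !inE.
have xyF : fadj F x y by rewrite /fadj xy -fE.
suff -> : connect (fadj F) u x = connect (fadj F) u y by rewrite addbb.
apply/idP/idP => c; apply: connect_trans c _; apply: connect1 => //.
by rewrite fadj_sym.
Qed.

(** The edges of one component form a connected bridgeless set and the rest stays bridgeless:
    induction on the number of edges. *)
Lemma sum_bridgeless (R : realFieldType) (phi : {set V} -> R) F : simple F ->
  (forall F', F' \subset F -> bridgeless F' -> conn F' -> \sum_(f in F') phi f = 0) ->
  bridgeless F -> \sum_(f in F) phi f = 0.
Proof.
have [n] := ubnP #|F|; elim: n F => // n IHn F ltn sF phi0 bF.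
have [->|[f fF]] := set_0Vmem F; first by rewrite big_set0.
have /eqP/cards2P[u [v [_ fE]]] := sF f fF.
set C := [set v | connect (fadj F) u v].
have cC : cut F C = set0 by apply: cut_component.
pose F1 := [set h in F | h \subset C]; pose F2 := F :\: F1.
have sF1 : F1 \subset F by apply/subsetP => h /setIdP[].
have sF2 : F2 \subset F by apply: subsetDl.
have inout h : h \in F -> (h \subset C) || [disjoint h & C].
  move=> hF; have : h \notin cut F C by rewrite cC inE.
  rewrite in_cut hF /= negb_and !negbK setD_eq0 setI_eq0.
  by rewrite orbC.
have cr1 h X : h \in F1 -> crosses h (X :&: C) = crosses h X.
  case/setIdP => hF hC; rewrite /crosses setIA setIAC (setIidPl hC).
  congr (_ && (_ != _)); apply/setP => x; rewrite !(in_setD, in_setI).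
  by case hx: (x \in h); rewrite ?andbF // (subsetP hC) ?andbT.
have F2out h : h \in F2 -> h :&: C = set0.
  move=> /setDP[hF]; rewrite inE hF /= => hC.
  by apply/eqP; rewrite setI_eq0; have := inout h hF; rewrite (negPf hC).
have cut1 X : cut F1 X = cut F (X :&: C).
  apply/setP => h; rewrite !in_cut; case h1: (h \in F1) => /=.
    by rewrite cr1 // (subsetP sF1).
  case hF: (h \in F) => //=; apply/esym/negbTE; rewrite negb_and !negbK.
  by rewrite setICA F2out ?setI0 ?eqxx // inE h1 hF.
have cut2 X : cut F2 X = cut F (X :\: C).
  apply/setP => h; rewrite !in_cut inE; case hF: (h \in F); rewrite ?andbF //= andbT.
  case h1: (h \in F1) => /=.
    apply/esym/negbTE; rewrite negb_and !negbK; apply/orP; left; apply/eqP/setP => x.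
    have /setIdP[_ hC] := h1; rewrite in_setI in_setD in_set0.
    by case hx: (x \in h); rewrite //= (subsetP hC x hx).
  have h2 : h :&: C = set0 by apply: F2out; rewrite inE h1 hF.
  have hC x : x \in h -> x \in C = false.
    by move=> hx; have := in_set0 x; rewrite -h2 inE hx.
  by congr (_ && _); congr (_ != _); apply/setP => x; rewrite !(in_setD, in_setI);
    case hx: (x \in h); rewrite //= ?andbF // hC.
have b1 : bridgeless F1 by apply/forallP => X; rewrite cut1; apply: (forallP bF).
have b2 : bridgeless F2 by apply/forallP => X; rewrite cut2; apply: (forallP bF).
have fF1 : f \in F1.
  rewrite inE fF /=; have := inout f fF; rewrite fE => /orP[//|].
  by move/disjointFr/(_ (set21 u v)); rewrite inE connect0.
have c1 : conn F1.
  apply/forallP => X; apply/implyP => /eqP; rewrite cut1 => cX.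
  have covC x : x \in cover F1 -> connect (fadj F) u x.
    by case/bigcupP => h /setIdP[_ /subsetP hC] /hC; rewrite inE.
  have CX x : connect (fadj F) u x -> (x \in X) = (u \in X).
    move=> ux; have := cut0_connect cX ux; rewrite !inE connect0 ux !andbT.
    by move->.
  case uX: (u \in X); apply/orP; [left|right].
    by apply/subsetP => x /covC/CX->.
  by rewrite disjoints_subset; apply/subsetP => x /covC/CX; rewrite uX inE => ->.
rewrite (big_setID F1) /= (setIidPr sF1) phi0 // add0r; apply: IHn => //.
- apply: leq_trans (_ : #|F| <= n)%N; last by [].
  apply: proper_card; apply/properP; split=> //; exists f => //.
  by rewrite inE fF1.
- exact: simpleS sF.
- by move=> F' sF'; apply: phi0; apply: subset_trans sF' _.
Qed.

Lemma connP F : simple F -> conn F ->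
  forall u v, u \in cover F -> v \in cover F -> connect (fadj F) u v.
Proof.
move=> sF /forallP cF u v uF vF.
have := cF [set w | connect (fadj F) u w].
rewrite cut_component // eqxx => /orP[].
  by move/subsetP/(_ v vF); rewrite inE.
by move/disjointFr/(_ uF); rewrite inE connect0.
Qed.

Lemma is_graph_simple W F : is_graph W F -> simple F.
Proof. by move=> gF f /gF[]. Qed.

(** If the ends of [f] stay connected without [f], the components do not change and no cut is [{f}].
    Otherwise the component of [u] in [F :\ f] has cut [{f}], and sending roots of [F :\ f] to roots
    of [F] is onto but not injective. *)
Lemma ncomp_bridge W F f : is_graph W F ->
  is_bridge W F f <-> exists X, cut F X = [set f].
Proof.
move=> gF; have sF := is_graph_simple gF.
have [fF|nfF] := boolP (f \in F); last first.
  split=> [[]|[X cX]]; first by rewrite (negPf nfF).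
  have : f \in cut F X by rewrite cX set11.
  by rewrite in_cut (negPf nfF).
have /eqP/cards2P[u [v [uv fE]]] := sF f fF.
pose F' := F :\ f.
have sF' : simple F' by apply: simpleS sF; apply: subD1set.
have csym E : connect_sym (fadj E) by apply/sym_connect_sym/fadj_sym.
have sub : subrel (connect (fadj F')) (connect (fadj F)).
  apply: connect_sub => x y /andP[xy]; rewrite inE => /andP[_ xyF].
  by apply: connect1; rewrite /fadj xy.
have uvF : connect (fadj F) u v by apply: connect1; rewrite /fadj uv -fE.
(* [ncomp] counts classes of the already transitive [connect (fadj F)]; its roots are those of
   [fadj F]. *)
have root2 E x : fingraph.root (connect (fadj E)) x = fingraph.root (fadj E) x.
  rewrite /fingraph.root; congr odflt; apply: eq_pick => y /=.
  apply/idP/idP => [|/connect1//].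
  by apply: connect_sub.
have ncE E : ncomp W E = #|[set x in W | roots (fadj E) x]|.
  rewrite /ncomp /n_comp_mem; apply: eq_card => x.
  by rewrite !inE /= /roots /= root2 andbC.
have [c'|c'] := boolP (connect (fadj F') u v).
  have eqc : connect (fadj F') =2 connect (fadj F).
    move=> x y; apply/idP/idP; first exact: sub.
    apply: connect_sub => a b /andP[ab abF].
    have [abf|abf] := eqVneq [set a; b] f; last first.
      by apply: connect1; rewrite /fadj ab !inE abf.
    have : (a \in [set u; v]) && (b \in [set u; v]).
      by rewrite -fE -abf !inE !eqxx orbT.
    rewrite !inE => /andP[/orP[]/eqP-> /orP[]/eqP->] //; last by rewrite csym.
  split=> [[_]|[X cX]].
    rewrite !ncE [X in (_ < X)%N](_ : _ = #|[set x in W | roots (fadj F) x]|) ?ltnn //.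
    apply: eq_card => x; rewrite !inE /roots /fingraph.root; congr (_ && (odflt _ _ == _)).
    by apply: eq_pick => y; apply: eqc.
  have cX' : cut F' X = set0.
    apply/eqP; rewrite -subset0; apply/subsetP => x; rewrite in_cut inE.
    case/andP=> /andP[xf xF] cr; have : x \in cut F X by rewrite in_cut xF.
    by rewrite cX (negPf xf).
  have := cut0_connect cX' c'.
  have : f \in cut F X by rewrite cX set11.
  by rewrite in_cut fE crosses2 => /andP[_] /[swap] ->; rewrite addbb.
split=> [_|_].
  exists [set w | connect (fadj F') u w]; apply/setP => x.
  have := cut_component u sF'; move/setP/(_ x); rewrite !in_cut !inE.
  have [->|xf] := eqVneq x f => /=.
    by rewrite fF fE crosses2 !inE connect0 (negPf c').
  by [].
split=> //; rewrite !ncE.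
have Wroot E x : E \subset F -> x \in W -> fingraph.root (fadj E) x \in W.
  move=> sE xW; rewrite -(@closed_connect _ (fadj E) (mem W) _ x) //; last exact: connect_root.
  apply: intro_closed => [|a b /andP[_ abE] _]; first exact: csym.
  by have [/subsetP abW _] := gF _ (subsetP sE _ abE); apply: abW; rewrite !inE eqxx orbT.
have [uW vW] : u \in W /\ v \in W.
  by have [/subsetP fW _] := gF f fF; split; apply: fW; rewrite fE !inE eqxx ?orbT.
have sF'F : F' \subset F by apply: subD1set.
set A' := [set x in W | roots (fadj F') x].
have -> : [set x in W | roots (fadj F) x] = fingraph.root (fadj F) @: A'.
  apply/setP => x; apply/setIdP/imsetP => [[xW /eqP rx]|[y /setIdP[yW _] ->]].
    exists (fingraph.root (fadj F') x).
      by rewrite inE Wroot // roots_root.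
    by rewrite -[LHS]rx; apply/fingraph.rootP => //; apply/sub/connect_root.
  by rewrite Wroot // roots_root.
rewrite ltn_neqAle leq_imset_card andbT; apply/negP => /imset_injP inj.
move/negP: c'; apply; rewrite -root_connect //; apply/eqP; apply: inj.
- by rewrite inE Wroot // roots_root.
- by rewrite inE Wroot // roots_root.
- have rr x : fingraph.root (fadj F) (fingraph.root (fadj F') x) = fingraph.root (fadj F) x.
    by apply/esym/fingraph.rootP => //; apply/sub/connect_root.
  by rewrite !rr; apply/fingraph.rootP.
Qed.

Lemma two_ec_bridgeless W F : is_graph W F -> two_ec W F -> bridgeless F.
Proof.
move=> gF [_ nb]; apply/forallP => X; apply/negP => /cards1P[f cf].
by apply: (nb f); apply/ncomp_bridge => //; exists X.
Qed.

(** Connectivity on any [W] connects the ends of edges; in return [cover F] serves as vertex set,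
    the empty edge set giving the empty graph. *)
Lemma two_ecP E F : simple E ->
  (exists W, (is_graph W F /\ F \subset E) /\ two_ec W F) <->
  [&& F \subset E, bridgeless F & conn F].
Proof.
move=> sE; split=> [[W [[gF sFE] tF]]|/and3P[sFE bF cF]].
  rewrite sFE (two_ec_bridgeless gF) //=; apply/forallP => X; apply/implyP => /eqP cX.
  have sub : cover F \subset W by apply/bigcupsP => f /gF[].
  have [e0|[u ucov]] := set_0Vmem (cover F); first by rewrite e0 sub0set.
  have inX x : x \in cover F -> (x \in X) = (u \in X).
    move=> xc; apply/esym/(cut0_connect cX); apply: tF.1; exact: (subsetP sub).
  case uX: (u \in X); apply/orP; [left|right].
    by apply/subsetP => x /inX->.
  by rewrite disjoints_subset; apply/subsetP => x /inX; rewrite uX inE => ->.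
have sF := simpleS sFE sE.
have gF : is_graph (cover F) F by move=> f fF; split; [apply: bigcup_sup|apply: sF].
exists (cover F); split=> //; split; first exact: connP.
by move=> f /(ncomp_bridge _ gF)[X]; apply: bridgelessP.
Qed.

End Cuts.

(** * Coparallel classes of arbitrary edge sets *)

Section CoparallelClasses.
Variables (R : realFieldType) (V : finType).
Implicit Types (f h b d : {set V}) (X Y S : {set V}) (F E A : {set {set V}}).

(** Defined for any edge set, since classes of subgraphs are compared; in a 2-edge-connected graph
    every 2-cut is minimal and this is the coparallel class of [b]. *)
Definition cls F b := [set d in F | (d == b) || [exists X, cut F X == [set b; d]]].

Lemma clsP F b d :
  reflect (d \in F /\ (d = b \/ exists X, cut F X = [set b; d])) (d \in cls F b).
Proof.
apply: (iffP setIdP) => -[dF H]; split=> //.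
  by case/orP: H => [/eqP|/existsP[X /eqP]]; [left|right; exists X].
by case: H => [->|[X cX]]; rewrite ?eqxx //; apply/orP; right; apply/existsP; exists X; apply/eqP.
Qed.

Lemma cls_refl F b : b \in F -> b \in cls F b.
Proof. by move=> bF; apply/clsP; split; [|left]. Qed.

Lemma cls_sub F b : cls F b \subset F.
Proof. by apply/subsetP => d /clsP[]. Qed.

Lemma in_cutE F X A f : cut F X = A -> f \in F -> crosses f X = (f \in A).
Proof. by move=> <- fF; rewrite in_cut fF. Qed.

Lemma cut_eq F X A : A \subset F -> (forall f, f \in F -> crosses f X = (f \in A)) ->
  cut F X = A.
Proof.
move=> /subsetP sA cA; apply/setP => f; rewrite in_cut.
case fF: (f \in F); rewrite /= ?cA //.
by apply/esym/negP => /sA; rewrite fF.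
Qed.

Lemma mem_pair (T : finType) (a b x : T) : (x \in [set a; b]) = (x == a) || (x == b).
Proof. by rewrite !inE. Qed.

Lemma cls_sym F b d : b \in F -> d \in cls F b -> b \in cls F d.
Proof.
move=> bF /clsP[_ [->|[X cX]]]; first exact: cls_refl.
by apply/clsP; split=> //; right; exists X; rewrite setUC.
Qed.

(** The sum of the cuts [{b, d}] and [{d, x}] is [{b, x}]. *)
Lemma cls_trans F b d x : simple F -> b \in F ->
  d \in cls F b -> x \in cls F d -> x \in cls F b.
Proof.
move=> sF bF db /clsP[xF [->//|[Y cY]]].
case/clsP: db cY => dF [->|[X cX]] cY; first by apply/clsP; split=> //; right; exists Y.
have [->|xb] := eqVneq x b; first exact: cls_refl.
apply/clsP; split=> //.
have [xd|xd] := eqVneq x d; first by rewrite xd; right; exists X.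
have [bd|bd] := eqVneq b d; first by right; exists Y; rewrite bd.
right; exists (symd X Y); rewrite cut_symd // cX cY; apply/setP => z; rewrite !inE.
have [->|zb] := eqVneq z b; first by rewrite (negPf bd) eq_sym (negPf xb).
have [->|zd] /= := eqVneq z d; last by [].
by rewrite eq_sym (negPf xd).
Qed.

(** If [{d}] were a cut, adding the cut [{b, d}] would make [{b}] one. *)
Lemma cls_core F b : simple F -> b \in core F -> cls F b \subset core F.
Proof.
move=> sF bc; apply/subsetP => d /clsP[dF [->//|[X cX]]].
have [->//|db] := eqVneq d b.
apply/coreP; split=> // Y cY; case/coreP: bc => bF /(_ (symd X Y)); apply.
rewrite cut_symd // cX cY; apply/setP => z; rewrite !inE.
by have [->|_] := eqVneq z b; [rewrite eq_sym (negPf db)|case: eqP].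
Qed.

(** Deleting [b] turns into bridges exactly the core edges that form a 2-cut with [b]. *)
Lemma core_del F b : b \in core F -> core (F :\ b) = core F :\: cls F b.
Proof.
move=> bc; have bF := subsetP (core_sub F) b bc; apply/setP => d; rewrite in_setD.
apply/coreP/andP => [[]|[dn /coreP[dF dc]]].
  rewrite in_setD1 => /andP[db dF] dc; split.
    apply/negP => /clsP[_ [E|[X cX]]]; first by rewrite E eqxx in db.
    apply: (dc X); apply: cut_eq; first by rewrite sub1set !inE db.
    move=> f /setD1P[fb fF]; rewrite (in_cutE cX fF) !inE (negPf fb).
    by case: eqP.
  apply/coreP; split=> // X cX; apply: (dc X); apply: cut_eq.
    by rewrite sub1set !inE db.
  by move=> f /setD1P[fb fF]; rewrite (in_cutE cX fF).
have db : d != b by apply: contraNneq dn => ->; apply: cls_refl.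
split; first by rewrite !inE db.
move=> X cX; case bX: (crosses b X).
  case/negP: dn; apply/clsP; split=> //; right; exists X; apply: cut_eq.
    by apply/subsetP => z /set2P[]->.
  move=> f fF; rewrite !inE; have [->|fb] := eqVneq f b; first by rewrite bX.
  by rewrite (in_cutE cX) ?inE ?fb.
apply: (dc X); apply: cut_eq; first by rewrite sub1set.
move=> f fF; rewrite !inE; have [->|fb] := eqVneq f b.
  by rewrite bX eq_sym (negPf db).
by rewrite (in_cutE cX) ?inE ?fb.
Qed.

(** By [core_del] the class is the difference of the cores of [F] and [F :\ b], on both of which
    [phi] sums to zero. *)
Lemma sum_cls0 (phi : {set V} -> R) F b : simple F ->
  (forall F', F' \subset F -> \sum_(f in core F') phi f = 0) ->
  b \in core F -> \sum_(f in cls F b) phi f = 0.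
Proof.
move=> sF phi0 bc; have := phi0 F (subxx F).
rewrite (big_setID (cls F b)) /= (setIidPr (cls_core sF bc)) -core_del //.
by rewrite phi0 ?addr0 // subD1set.
Qed.

(** A cut [{b, d}] of [E] with [d] outside [F] would leave the cut [{b}] in [F]. *)
Lemma bridgeless_closed E F b : F \subset E -> bridgeless F -> b \in F ->
  cls E b \subset F.
Proof.
move=> sFE bF bb; apply/subsetP => d /clsP[dE [->//|[X cX]]].
apply: contraT => dF; case: (@bridgelessP _ F X b bF); apply: cut_eq.
  by rewrite sub1set.
move=> f fF; rewrite (in_cutE cX) ?(subsetP sFE) // !inE.
by case: (eqVneq f d) => [fd|_]; [rewrite -fd fF in dF|rewrite orbF].
Qed.

(** A set closed under classes is a disjoint union of classes, removed here one at a time. *)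
Lemma sum_closed0 (psi : {set V} -> R) E F : simple E -> F \subset E ->
  (forall b, b \in F -> cls E b \subset F) ->
  (forall b, b \in E -> \sum_(f in cls E b) psi f = 0) ->
  \sum_(f in F) psi f = 0.
Proof.
move=> sE; have [n] := ubnP #|F|; elim: n F => // n IHn F ltn sF cF psi0.
have [->|[b bF]] := set_0Vmem F; first by rewrite big_set0.
have bE := subsetP sF b bF.
rewrite (big_setID (cls E b)) /= (setIidPr (cF b bF)) psi0 // add0r.
apply: IHn => //.
- apply: leq_trans (_ : #|F| <= n)%N; last by [].
  apply: proper_card; apply/properP; split; first exact: subsetDl.
  by exists b => //; rewrite inE cls_refl.
- exact: subset_trans (subsetDl _ _) sF.
- move=> d /setDP[dF db]; apply/subsetP => x xd; rewrite inE (subsetP (cF d dF)) // andbT.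
  apply: contra db => xb; apply: (cls_trans sE bE xb).
  by apply: cls_sym => //; apply: (subsetP sF).
Qed.

Lemma notcrosses_pairwise f X Y : #|f| = 2%N -> ~~ crosses f X -> ~~ crosses f Y ->
  [&& ~~ crosses f (X :\: Y), ~~ crosses f (X :&: Y) & ~~ crosses f (X :|: Y)].
Proof.
move=> /eqP/cards2P[u [v [_ ->]]]; rewrite !crosses2 !inE.
by do 4!case: (_ \in _).
Qed.

End CoparallelClasses.

(** * The two sides of a minimal cut *)

Section MinimalCut.
Variables (R : realFieldType) (V : finType) (E : {set {set V}}).
Hypothesis sE : simple E.
Implicit Types (f h b d : {set V}) (X Y S : {set V}) (F : {set {set V}}).

Definition inner S := [set f in E | f \subset S].
(** Connectivity of [G[S]] in the language of cuts. *)
Definition side_conn S :=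
  forall X, cut (inner S) X = set0 -> X :&: S = set0 \/ S \subset X.

Lemma inner_sub S : inner S \subset E.
Proof. by apply/subsetP => f /setIdP[]. Qed.

(** If [Y] is a proper nonempty part of [S] with no edge to the rest of [S], its cut lies in that of
    [S], so equals it by minimality; then the cut of [symd Y S] is empty, contradicting
    connectivity. *)
Lemma minimal_cut_side_conn S :
  (forall X, cut E X = set0 -> X = set0 \/ X = setT) ->
  (forall X, X != set0 -> X != setT -> ~ cut E X \proper cut E S) ->
  side_conn S.
Proof.
move=> cE mS X cX; set Y := X :&: S.
have [->|Y0] := eqVneq Y set0; first by left.
have [YS|nYS] := boolP (S \subset Y).
  by right; apply: subset_trans YS (subsetIl _ _).
have sub : cut E Y \subset cut E S.
  apply/subsetP => f; rewrite !in_cut => /andP[fE fY]; rewrite fE /=.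
  have [fS|fS] := boolP (f \subset S).
    have : f \notin cut (inner S) X by rewrite cX inE.
    rewrite in_cut inE fE fS /= => /negP[].
    case/andP: fY => /set0Pn[x /setIP[xf /setIP[xX _]]] /set0Pn[y /setDP[yf yY]].
    apply/andP; split; apply/set0Pn.
      by exists x; rewrite inE xf.
    exists y; rewrite inE yf andbT; apply: contra yY => yX.
    by rewrite inE yX (subsetP fS).
  case/andP: fY => /set0Pn[x /setIP[xf /setIP[_ xS]]] _.
  by apply/andP; split; [apply/set0Pn; exists x; rewrite inE xf|rewrite setD_eq0].
have YT : Y != setT by apply: contraNneq nYS => ->; apply: subsetT.
have eqc : cut E Y = cut E S.
  by apply/eqP; rewrite eqEproper sub /=; apply/negP/mS.
have : cut E (symd Y S) = set0.
  by rewrite cut_symd // eqc; apply/setP => f; rewrite !inE addbb.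
have /subsetPn[x xS xY] := nYS.
have /set0Pn[y yY] := Y0; have yS : y \in S by move: yY; rewrite inE => /andP[].
move/cE => [/setP/(_ x)|/setP/(_ y)]; rewrite !in_set ?xS ?yS.
  by rewrite andbT; move: xY; rewrite inE xS andbT => /negPf->.
by move: yY; rewrite inE => /andP[-> _].
Qed.

(* With [D] the cut [cut E S], this is [G] without the cut edges other than [e], [h]. *)
Definition pair_sub (D : {set {set V}}) (e h : {set V}) :=
  [set f in E | (f \notin D) || (f == e) || (f == h)].

Lemma notin_cut_inner S f : f \in E -> f \notin cut E S ->
  f \in inner S \/ f \in inner (~: S).
Proof.
move=> fE; rewrite in_cut fE /= negb_and !negbK setD_eq0 setI_eq0.
rewrite disjoints_subset => /orP[fS|fS]; [right|left]; by rewrite inE fE.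
Qed.

Lemma inner_notin_cut S f : f \in inner S -> f \notin cut E S.
Proof.
by case/setIdP => fE fS; rewrite in_cut fE /= negb_and !negbK setD_eq0 fS orbT.
Qed.

Lemma inner_disj S f : f \in inner S -> f \notin inner (~: S).
Proof.
case/setIdP => fE fS; rewrite inE fE /=; apply/negP => fC.
have /eqP/cards2P[u [v [_ fE2]]] := sE fE.
have uf : u \in f by rewrite fE2 set21.
by have := subsetP fC u uf; rewrite inE (subsetP fS).
Qed.

Lemma inner_pair_sub S e h : inner S \subset pair_sub (cut E S) e h.
Proof.
by apply/subsetP => f fi; rewrite inE (subsetP (inner_sub S)) //= inner_notin_cut.
Qed.

Lemma inner_pair_subC S e h : inner (~: S) \subset pair_sub (cut E S) e h.
Proof. by rewrite -cutC; apply: inner_pair_sub. Qed.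

Lemma pair_sub_sub D e h : pair_sub D e h \subset E.
Proof. by apply/subsetP => f /setIdP[]. Qed.

Lemma crosses_sub2 S X f : X \subset S -> crosses f S -> crosses f X = (f :&: X != set0).
Proof.
move=> XS /andP[_ fS]; rewrite /crosses; case: (f :&: X != set0) => //=.
apply: contraNneq fS => f0; rewrite -subset0 -f0; exact: setDS.
Qed.

Lemma inner_crosses_sub S X f : X \subset S -> f \in inner (~: S) -> ~~ crosses f X.
Proof.
move=> XS /setIdP[_ fC]; rewrite negb_and negbK -subset0; apply/orP; left.
apply/subsetP => x /setIP[xf xX].
by have := subsetP fC x xf; rewrite inE (subsetP XS).
Qed.

(** * Laminar structure of the 2-cuts of [G[S]] through [b] *)

Section Laminar.
Variables (S e b : {set V}).
Hypotheses (Sconn : side_conn S) (eS : e \in cut E S) (bc : b \in core (inner S)).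
Let F0 := inner S.
Let sF0 : simple F0 := simpleS (inner_sub S) sE.

(* The unique side, inside [S] and away from [e], of the 2-cut [{b, y}] of [G[S]]. *)
Definition good X y := [&& X \subset S, ~~ crosses e X & cut F0 X == [set b; y]].

Let eE : e \in E. Proof. by move: eS; rewrite in_cut => /andP[]. Qed.
Let ceS : crosses e S. Proof. by move: eS; rewrite in_cut => /andP[]. Qed.

Lemma cut0_empty X : X \subset S -> ~~ crosses e X -> cut F0 X = set0 -> X = set0.
Proof.
move=> XS eX /Sconn[|SX]; first by rewrite (setIidPl XS).
by have XE : X = S; [apply/eqP; rewrite eqEsubset XS|rewrite XE ceS in eX].
Qed.

Lemma good_ex y : y \in cls F0 b -> y != b -> exists X, good X y.
Proof.
case/clsP => yF [->|[X cX]]; first by rewrite eqxx.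
move=> yb; pose X1 := X :&: S.
have cX1 : cut F0 X1 = [set b; y].
  rewrite -cX; apply/setP => f; rewrite !in_cut; case fF: (f \in F0) => //=.
  have /setIdP[_ fS] := fF; rewrite /crosses setIA setIAC (setIidPl fS).
  congr (_ && (_ != _)); apply/setP => x; rewrite !inE.
  by case xf: (x \in f); rewrite ?andbF // (subsetP fS) ?andbT.
case ex: (crosses e X1); last first.
  by exists X1; rewrite /good subsetIr ex cX1 eqxx.
exists (symd X1 S); apply/and3P; split.
- by apply/subsetP => x; rewrite !inE; case: (x \in S); rewrite ?andbF ?andbT.
- by rewrite crosses_symd ?sE // ex ceS.
- rewrite cut_symd // cX1; apply/eqP/setP => f; rewrite [LHS]in_set.
  suff -> : cut F0 S = set0 by rewrite in_set0 addbF.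
  apply/eqP; rewrite -subset0; apply/subsetP => z; rewrite in_cut => /andP[zF zS].
  by have := inner_notin_cut zF; rewrite in_cut zS (subsetP (inner_sub S)).
Qed.

(** The symmetric difference of the two sides lies in [S], avoids [e] and has an empty cut in
    [G[S]], so it is empty. *)
Lemma good_uniq X X' y : good X y -> good X' y -> X = X'.
Proof.
case/and3P=> XS eX /eqP cX /and3P[XS' eX' /eqP cX'].
suff /setP s0 : symd X X' = set0.
  by apply/setP => x; have := s0 x; rewrite !inE; case: (x \in X); case: (x \in X').
apply: cut0_empty.
- by apply/subsetP => x; rewrite !inE; case xX: (x \in X); case xX': (x \in X') => // _;
    [apply: (subsetP XS)|apply: (subsetP XS')].
- by rewrite crosses_symd ?sE // (negPf eX) (negPf eX').
- by rewrite cut_symd // cX cX'; apply/setP => f; rewrite !inE addbb.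
Qed.

(** Neither core edge alone is a cut, so a nonempty cut inside [{y1, y2}] consists of both. *)
Lemma cut_pair X y1 y2 : y1 \in core F0 -> y2 \in core F0 ->
  cut F0 X \subset [set y1; y2] -> cut F0 X != set0 ->
  [/\ y1 \in cut F0 X, y2 \in cut F0 X & y1 != y2].
Proof.
move=> c1 c2 sub ne.
have one y : y \in core F0 -> cut F0 X != [set y].
  by case/coreP => _ /(_ X)/eqP.
have single y : cut F0 X \subset [set y] -> y \in core F0 -> False.
  move=> s cy; move: s (one y cy); rewrite subset1 => /orP[/eqP->|].
    by rewrite eqxx.
  by rewrite (negPf ne).
split.
- apply: contraT => n1; case: (single y2) => //; apply/subsetP => z zc.
  have := subsetP sub z zc; rewrite !inE => /orP[/eqP E1|//].
  by rewrite -E1 zc in n1.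
- apply: contraT => n2; case: (single y1) => //; apply/subsetP => z zc.
  have := subsetP sub z zc; rewrite !inE => /orP[//|/eqP E1].
  by rewrite -E1 zc in n2.
- apply/negP => /eqP E12; apply: (single y1) => //.
  by move: sub; rewrite -E12 setUid.
Qed.

(* The cuts of [A] and [B] lie in [{y1, y2}] and differ there by [{y1}] and
   [{y2}]; as none of them is a single edge, one is empty. *)
Lemma uncross X1 X2 y1 y2 A B :
  y1 \in cls F0 b -> y1 != b -> y2 \in cls F0 b -> y2 != b ->
  good X1 y1 -> good X2 y2 -> symd A B = symd X1 X2 ->
  (forall f, #|f| = 2%N -> ~~ crosses f X1 -> ~~ crosses f X2 -> ~~ crosses f A /\ ~~ crosses f B) ->
  ~~ crosses b A -> ~~ crosses b B -> A \subset S -> B \subset S ->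
  A = set0 \/ B = set0.
Proof.
move=> d1 n1 d2 n2 /and3P[S1 e1 /eqP c1] /and3P[S2 e2 /eqP c2] AB ncr bA bB AS BS.
have yc1 := subsetP (cls_core sF0 bc) _ d1.
have yc2 := subsetP (cls_core sF0 bc) _ d2.
have yF1 := subsetP (core_sub _) _ yc1.
have [neA neB] := ncr e (sE eE) e1 e2.
have sub C : ~~ crosses b C -> (forall f, #|f| = 2%N -> ~~ crosses f X1 -> ~~ crosses f X2 -> ~~ crosses f C) ->
    cut F0 C \subset [set y1; y2].
  move=> bC fC; apply/subsetP => f; rewrite in_cut => /andP[fF cf].
  apply: contraTT cf => fn; have [->//|fb] := eqVneq f b; apply: fC; first exact: sF0.
    by rewrite (in_cutE c1) // mem_pair (negPf fb) /=; apply: contra fn => /eqP->; rewrite set21.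
  by rewrite (in_cutE c2) // mem_pair (negPf fb) /=; apply: contra fn => /eqP->; rewrite set22.
have sA := sub A bA (fun f i j k => (ncr f i j k).1).
have sB := sub B bB (fun f i j k => (ncr f i j k).2).
have [cA|cA] := eqVneq (cut F0 A) set0; first by left; apply: cut0_empty.
have [cB|cB] := eqVneq (cut F0 B) set0; first by right; apply: cut0_empty.
have [A1 _ y12] := cut_pair yc1 yc2 sA cA.
have [B1 _ _] := cut_pair yc1 yc2 sB cB.
have := cut_symd A B sF0; rewrite AB cut_symd // c1 c2 => /setP/(_ y1).
by rewrite ![_ \in symd _ _]in_set A1 B1 !mem_pair (negPf n1) (negPf y12) eqxx.
Qed.

(** Both sides contain the end [w] of [b] and not the other end, so [b] crosses neither difference;
    by [uncross] one difference is empty. *)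
Lemma nested X1 X2 y1 y2 w :
  y1 \in cls F0 b -> y1 != b -> y2 \in cls F0 b -> y2 != b ->
  good X1 y1 -> good X2 y2 -> w \in b -> w \in X1 -> w \in X2 ->
  X1 \subset X2 \/ X2 \subset X1.
Proof.
move=> d1 n1 d2 n2 g1 g2 wb w1 w2.
have bF : b \in F0 by apply: (subsetP (core_sub _)).
have out X y z : good X y -> w \in X -> z \in b -> z != w -> z \notin X.
  case/and3P=> _ _ /eqP cX wX zb zw.
  have /eqP/cards2P[u [v [_ bE]]] := sF0 bF.
  have : crosses b X by rewrite (in_cutE cX) // set21.
  move: wb zb zw wX; rewrite bE crosses2 !inE => /orP[]/eqP-> /orP[]/eqP->;
    by rewrite ?eqxx // => _ ->; rewrite ?addbT.
have S1 : X1 \subset S by case/and3P: g1.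
have S2 : X2 \subset S by case/and3P: g2.
have nb X X' y : good X y -> w \in X -> w \in X' -> ~~ crosses b (X :\: X').
  move=> g wX wX'; rewrite negb_and negbK; apply/orP; left.
  rewrite -subset0; apply/subsetP => z /setIP[zb /setDP[zX zX']].
  have [zw|zw] := eqVneq z w; first by rewrite zw wX' in zX'.
  by have := out _ _ z g wX zb zw; rewrite zX.
have [] := uncross (A := X1 :\: X2) (B := X2 :\: X1) d1 n1 d2 n2 g1 g2.
- by apply/setP => x; rewrite !inE; case: (x \in X1); case: (x \in X2).
- move=> f f2 f1' f2'; split; first by case/and3P: (notcrosses_pairwise f2 f1' f2').
  by case/and3P: (notcrosses_pairwise f2 f2' f1').
- exact: nb g1 w1 w2.
- exact: nb g2 w2 w1.
- exact: subset_trans (subsetDl _ _) S1.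
- exact: subset_trans (subsetDl _ _) S2.
- by move/eqP; rewrite setD_eq0; left.
- by move/eqP; rewrite setD_eq0; right.
Qed.

(** The sides contain different ends of [b], so [b] crosses neither their intersection nor their
    union; by [uncross] one of these is empty, and the union contains [w]. *)
Lemma separated X1 X2 y1 y2 w :
  y1 \in cls F0 b -> y1 != b -> y2 \in cls F0 b -> y2 != b ->
  good X1 y1 -> good X2 y2 -> w \in b -> w \in X1 -> w \notin X2 ->
  X1 :&: X2 = set0.
Proof.
move=> d1 n1 d2 n2 g1 g2 wb w1 w2.
have bF : b \in F0 by apply: (subsetP (core_sub _)).
have S1 : X1 \subset S by case/and3P: g1.
have S2 : X2 \subset S by case/and3P: g2.
have [b1 b2] : crosses b X1 /\ crosses b X2.
  case/and3P: g1 => _ _ /eqP c1; case/and3P: g2 => _ _ /eqP c2.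
  by split; [rewrite (in_cutE c1)|rewrite (in_cutE c2)]; rewrite // set21.
have [nA nB] : ~~ crosses b (X1 :&: X2) /\ ~~ crosses b (X1 :|: X2).
  have /eqP/cards2P[u [v [_ bE]]] := sF0 bF.
  move: wb b1 b2; rewrite bE !crosses2 !inE.
  by case/orP=> /eqP E1; move: w1 w2; rewrite E1;
    case: (u \in X1); case: (u \in X2); case: (v \in X1); case: (v \in X2).
have [] := uncross (A := X1 :&: X2) (B := X1 :|: X2) d1 n1 d2 n2 g1 g2 => //.
- by apply/setP => x; rewrite !inE; case: (x \in X1); case: (x \in X2).
- by move=> f f2 f1' f2'; case/and3P: (notcrosses_pairwise f2 f1' f2').
- exact: subset_trans (subsetIl _ _) S1.
- by rewrite subUset S1.
- by move/setP/(_ w); rewrite !inE w1.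
Qed.

End Laminar.

End MinimalCut.

(** * Sufficiency: functionals on classes that miss the cut *)

Section FaceFunctional.
Variables (R : realFieldType) (V : finType) (E : {set {set V}}).
Hypothesis sE : simple E.
Variables (S e : {set V}) (phi : {set V} -> R).
Hypotheses (Sconn : side_conn E S) (Cconn : side_conn E (~: S)).
Hypothesis eS : e \in cut E S.
Notation G h := (pair_sub E (cut E S) e h).
(** Bridgeless subsets of [G h] meet the cut in nothing or in both [e] and [h], so they satisfy the
    inequality with equality; this is the form in which vanishing on the face enters. *)
Hypothesis phi0 : forall h, h \in cut E S -> h != e ->
  forall F : {set {set V}}, F \subset G h -> \sum_(f in core F) phi f = 0.

Let sG h : simple (G h) := simpleS (pair_sub_sub E (cut E S) e h) sE.

Lemma cutE_crosses f : f \in cut E S -> f \in E /\ crosses f S.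
Proof. by rewrite in_cut => /andP. Qed.

(** An edge [y] other than [b] in the class [D] of [b] in [G[S]] has a unique side [X], and [y] lies
    in the class [L h] of [b] in [G h] exactly when [h] does not touch [X]. Hence [y] is outside the
    class of [b] in [G] iff some cut edge touches [X]. Grouped by the end of [b] in [X], these [y]
    form two sets, each empty or of the form [D :\: L h]; as [phi] sums to zero on [D] and [L h], it
    does so on what remains. *)
Lemma sum_inner_class0 b h0 : h0 \in cut E S -> h0 != e ->
  b \in core (inner E S) -> (forall y, y \in cls E b -> y \notin cut E S) ->
  \sum_(f in cls E b) phi f = 0.
Proof.
move=> h0S h0e bc Kn.
set F0 := inner E S in bc; pose D := cls F0 b; pose L h := cls (G h) b.
have sF0 : simple F0 := simpleS (inner_sub E S) sE.
have bF : b \in F0 by apply: (subsetP (core_sub _)).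
have bE : b \in E by apply: (subsetP (inner_sub E S)).
have F0G h : F0 \subset G h by apply: inner_pair_sub.
have bG h : b \in core (G h).
  apply/coreP; split=> [|X cX]; first exact: (subsetP (F0G h)).
  case/coreP: bc => _ /(_ X); apply; apply: cut_eq; first by rewrite sub1set.
  by move=> f fF; rewrite (in_cutE cX) // (subsetP (F0G h)).
have sumL h : h \in cut E S -> h != e -> \sum_(f in L h) phi f = 0.
  by move=> hS he; apply: sum_cls0 (bG h) => // F' sF'; apply: phi0 sF'.
have sumD : \sum_(f in D) phi f = 0.
  apply: sum_cls0 bc => // F' sF'; apply: (phi0 h0S h0e).
  exact: subset_trans sF' (F0G h0).
(* As [b] is no bridge of [G[S]], an edge in a 2-cut with it in [G h] must lie in [G[S]]. *)
have LD h : L h \subset D.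
  apply/subsetP => y /clsP[yG [->|[X cX]]]; first exact: cls_refl.
  have yF : y \in F0.
    apply: contraT => nyF; case/coreP: bc => _ /(_ X) []; apply: cut_eq.
      by rewrite sub1set.
    move=> f fF; rewrite (in_cutE cX) ?(subsetP (F0G h)) // !inE.
    by case: (eqVneq f y) => [fy|]; [rewrite -fy fF in nyF|rewrite orbF].
  apply/clsP; split=> //; right; exists X; apply: cut_eq.
    by apply/subsetP => z /set2P[]->.
  by move=> f fF; rewrite (in_cutE cX) ?(subsetP (F0G h)).
(* Edges of the opposite side never cross [X], so only the cut edges in [F] decide whether the 2-cut
   survives. *)
have cut_lift X y (F : {set {set V}}) : F \subset E -> F0 \subset F -> y \in F0 -> good E S e b X y ->
    (forall h, h \in F -> h \in cut E S -> ~~ crosses h X) -> cut F X = [set b; y].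
  move=> sFE sF0F yF /and3P[XS eX /eqP cX] nX; apply: cut_eq.
    by apply/subsetP => z /set2P[]->; apply: (subsetP sF0F).
  move=> f fF; have fE := subsetP sFE f fF.
  have [fi|fni] := boolP (f \in F0); first by rewrite (in_cutE cX).
  rewrite (_ : (f \in [set b; y]) = false); last first.
    by rewrite mem_pair; apply: contraNF fni => /orP[]/eqP->.
  apply/negbTE; have [fS|fS] := boolP (f \in cut E S); first exact: nX.
  have [fi|fi] := notin_cut_inner fE fS; first by rewrite fi in fni.
  exact: inner_crosses_sub fi.
(* By connectivity of the opposite side, a 2-cut of [G h] for [y] has a side contained in [S]; by
   uniqueness it is [X]. *)
have inL h X y : h \in cut E S -> h != e -> y \in D -> y != b ->
    good E S e b X y -> (y \in L h) = ~~ crosses h X.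
  move=> hS he yD yb gX; have yF := subsetP (cls_sub _ _) _ yD.
  have [hE hcS] := cutE_crosses hS; have [eE ecS] := cutE_crosses eS.
  have hG : h \in G h by rewrite inE hE eqxx orbT.
  have eG : e \in G h by rewrite inE eE eqxx orbT.
  apply/idP/idP => [/clsP[_ [E1|[X' cX']]]|hX]; first by rewrite E1 eqxx in yb.
    have nin f : f \in cut E S -> (f \in [set b; y]) = false.
      move=> fS; apply/negbTE; rewrite mem_pair negb_or.
      by apply/andP; split; apply: contraTneq fS => ->; apply: inner_notin_cut.
    suff [Y [YS cY]] : exists Y : {set V}, Y \subset S /\ cut (G h) Y = [set b; y].
      have gY : good E S e b Y y.
        rewrite /good YS (in_cutE cY) // nin //=; apply/eqP/cut_eq.
          by apply/subsetP => z /set2P[]->.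
        by move=> f fF; rewrite (in_cutE cY) // (subsetP (F0G h)).
      by rewrite (good_uniq sE Sconn eS gX gY) (in_cutE cY) // nin.
    have [] := Cconn (X := X').
      apply/eqP; rewrite -subset0; apply/subsetP => z; rewrite in_cut => /andP[zi].
      rewrite (in_cutE cX') ?(subsetP (inner_pair_subC E S e h)) // => /set2P zE.
      by case: zE zi => ->; rewrite (negPf (inner_disj sE _)).
    - move=> X0; exists X'; split=> //; apply/subsetP => x xX; apply: contraT => xS.
      by have := in_set0 x; rewrite -X0 !inE xX xS.
    - move=> CX; exists (~: X'); split; last by rewrite cutC.
      by rewrite -setCS setCK.
  apply/clsP; split; first exact: (subsetP (F0G h)).
  right; exists X; apply: cut_lift (gX) _ => //; first exact: pair_sub_sub.
  move=> f /setIdP[_ fG] fS; move: fG; rewrite fS /= => /orP[]/eqP-> //.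
  by case/and3P: gX.
have KL h : h \in cut E S -> h != e -> cls E b \subset L h.
  move=> hS he; apply/subsetP => y yK; have /clsP[yE H] := yK; apply/clsP.
  have yG : y \in G h by rewrite inE yE Kn.
  split=> //; case: H => [|[X cX]]; [by left|right; exists X]; apply: cut_eq.
    by apply/subsetP => z /set2P[]-> //; apply: (subsetP (F0G h)).
  by move=> f fG; rewrite (in_cutE cX) // (subsetP (pair_sub_sub E (cut E S) e h)).
have KD : cls E b \subset D by apply: subset_trans (KL h0 h0S h0e) (LD h0).
have bS : b \subset S by case/setIdP: bF.
(* [T w] collects the [y] whose side contains the end [w] of [b] and is touched by a cut edge other
   than [e]. *)
pose T w := [set y in D | (y != b) && [exists X, [exists h,
  [&& good E S e b X y, w \in X, h \in cut E S, h != e & crosses h X]]]].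
have TP w y : reflect (exists X h, [/\ y \in D, y != b, good E S e b X y, w \in X &
    [/\ h \in cut E S, h != e & crosses h X]]) (y \in T w).
  apply: (iffP setIdP) => [[yD /andP[yb /existsP[X /existsP[h /and5P[*]]]]]|].
    by exists X, h.
  case=> X [h [yD yb gX wX [hS he hX]]]; split=> //; rewrite yb /=.
  by apply/existsP; exists X; apply/existsP; exists h; apply/and5P.
have sumT w : w \in b -> \sum_(f in T w) phi f = 0.
  move=> wb; have [->|[y0 y0T]] := set_0Vmem (T w); first by rewrite big_set0.
  pose P X := [exists y, exists h, [&& y \in D, y != b, good E S e b X y, w \in X &
    [&& h \in cut E S, h != e & crosses h X]]].
  have [X0 PX0] : exists X, P X.
    case/TP: y0T => X [h [y0D y0b gX wX [hS he hX]]]; exists X.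
    by apply/existsP; exists y0; apply/existsP; exists h; rewrite y0D y0b gX wX hS he hX.
  have [X1 /existsP[y1 /existsP[h1 /and5P[y1D y1b g1 wX1 /and3P[h1S h1e h1X]]]] minX1] :=
    arg_minnP (fun X : {set V} => #|X|) PX0.
  (* The sides containing [w] form a chain: a cut edge meeting the smallest one
     meets them all, and it meets no side containing the other end of [b]. *)
  suff -> : T w = D :\: L h1.
    have := sumD; rewrite (big_setID (L h1)) /= (setIidPr (LD h1)) sumL //.
    by rewrite add0r.
  have XS1 : X1 \subset S by case/and3P: g1.
  have h1cS := (cutE_crosses h1S).2.
  apply/setP => y; rewrite in_setD; apply/TP/andP => [[X [h [yD yb gX wX [hS he hX]]]]|[yL yD]].
    split=> //; have XS : X \subset S by case/and3P: gX.
    rewrite (inL h1 X) // negbK.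
    have sub : X1 \subset X.
      have [//|XX1] := nested sE Sconn eS bc y1D y1b yD yb g1 gX wb wX1 wX.
      suff -> : X1 = X by [].
      apply/eqP; rewrite eq_sym eqEcard XX1 minX1 //.
      by apply/existsP; exists y; apply/existsP; exists h; rewrite yD yb gX wX hS he hX.
    move: h1X; rewrite !(crosses_sub2 _ h1cS) //.
    case/set0Pn => x /setIP[xh xX1]; apply/set0Pn; exists x.
    by rewrite inE xh (subsetP sub).
  have yb : y != b.
    by apply: contraNneq yL => ->; apply: cls_refl; apply: (subsetP (core_sub _)).
  have [X gX] := good_ex sE eS yD yb.
  have XS : X \subset S by case/and3P: gX.
  have hX : crosses h1 X by move: yL; rewrite (inL h1 X) // negbK.
  exists X, h1; split=> //; apply: contraT => wX.
  (* [h1] has only one end in [S], so it cannot touch both of the disjoint sides [X] and [X1]. *)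
  have /setP X0' := separated sE Sconn eS bc y1D y1b yD yb g1 gX wb wX1 wX.
  have /eqP/cards2P[p [q [_ h1E]]] := sE (cutE_crosses h1S).1.
  move: h1cS hX h1X (X0' p) (X0' q); rewrite h1E !crosses2 !inE.
  have XS' x : (x \in X) ==> (x \in S) by apply/implyP/(subsetP XS).
  have XS1' x : (x \in X1) ==> (x \in S) by apply/implyP/(subsetP XS1).
  move: (XS' p) (XS' q) (XS1' p) (XS1' q).
  by case: (p \in X); case: (q \in X); case: (p \in X1); case: (q \in X1);
    case: (p \in S); case: (q \in S).
have /eqP/cards2P[u [v [uv bE2]]] := sF0 b bF.
(* If no cut edge touches the side of [y], its 2-cut lifts to [G]; [e] never touches it by the
   choice of side. *)
have DK : D :\: cls E b = T u :|: T v.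
  apply/setP => y; rewrite in_setD in_setU; apply/andP/orP => [[yK yD]|yT].
    have yb : y != b by apply: contraNneq yK => ->; apply: cls_refl.
    have yF := subsetP (cls_sub _ _) _ yD.
    have [X gX] := good_ex sE eS yD yb.
    have [h /and3P[hS he hX]] : exists h, [&& h \in cut E S, h != e & crosses h X].
      apply/existsP; apply: contraNT yK => /existsPn none; apply/clsP.
      split; first exact: (subsetP (inner_sub E S)).
      right; exists X; apply: cut_lift (gX) _ => //; first exact: inner_sub.
      move=> h _ hS; have := none h; rewrite hS /=.
      have [->|//] := eqVneq h e; by case/and3P: gX.
    have : crosses b X.
      by case/and3P: gX => _ _ /eqP cX; rewrite (in_cutE cX) // set21.
    rewrite bE2 crosses2; case uX: (u \in X) => /= vX; [left|right];
      by apply/TP; exists X, h.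
  have notK w : y \in T w -> y \notin cls E b /\ y \in D.
    case/TP => X [h [yD yb gX wX [hS he hX]]]; split=> //.
    apply/negP => /(subsetP (KL h hS he)).
    by rewrite (inL h X) // hX.
  by case: yT => /notK.
have Tdisj : [disjoint T u & T v].
  rewrite -setI_eq0 -subset0; apply/subsetP => y /setIP[/TP[X [h [_ _ gX uX _]]]].
  case/TP => X' [h' [_ _ gX' vX _]]; rewrite -(good_uniq sE Sconn eS gX gX') in vX.
  have : crosses b X.
    by case/and3P: gX => _ _ /eqP cX; rewrite (in_cutE cX) // set21.
  by rewrite bE2 crosses2 uX vX.
have TI : (T u :|: T v) :&: T u = T u by apply/setIidPr/subsetUl.
have TD : (T u :|: T v) :\: T u = T v.
  by rewrite setDUl setDv set0U; apply/setDidPl; rewrite disjoint_sym.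
have sumTT : \sum_(f in T u :|: T v) phi f = 0.
  rewrite (big_setID (T u)) TI TD /= !sumT ?addr0 //; first by rewrite bE2 set22.
  by rewrite bE2 set21.
by have := sumD; rewrite (big_setID (cls E b)) (setIidPr KD) DK /= sumTT addr0.
Qed.

End FaceFunctional.

(** * Sufficiency: classes that meet the cut, and the value of a functional *)

Section FaceFunctionalValue.
Variables (R : realFieldType) (V : finType) (E : {set {set V}}).
Hypothesis sE : simple E.
Variables (S e : {set V}) (phi : {set V} -> R).
Hypotheses (Sconn : side_conn E S) (Cconn : side_conn E (~: S)).
Hypothesis eS : e \in cut E S.
Notation G h := (pair_sub E (cut E S) e h).

Let sG h : simple (G h) := simpleS (pair_sub_sub E (cut E S) e h) sE.

Lemma mem_pair_sub h : h \in cut E S -> e \in G h /\ h \in G h.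
Proof.
move=> /cutE_crosses[hE _]; have [eE _] := cutE_crosses eS.
by rewrite !inE hE eE !eqxx !orbT.
Qed.

Lemma cut_pair_sub h : h \in cut E S -> cut (G h) S = [set e; h].
Proof.
move=> hS; have [eG hG] := mem_pair_sub hS; apply: cut_eq.
  by apply/subsetP => z /set2P[]->.
move=> f /setIdP[fE]; rewrite mem_pair in_cut fE /= -orbA.
case cf: (crosses f S) ; first by move=> /= ->.
move=> _; apply/esym/negbTE/negP => /orP[]/eqP fe; move: cf; rewrite fe.
  by have [_ ->] := cutE_crosses eS.
by have [_ ->] := cutE_crosses hS.
Qed.

(** If [X] had cut [{e}], no edge inside either side would cross [X]; both sides being connected,
    [X] is empty, everything, [S] or its complement, and none of these is crossed by [e] but not by
    [h]. *)
Lemma cut_core h : h \in cut E S -> h != e -> e \in core (G h).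
Proof.
move=> hS he; have [eG hG] := mem_pair_sub hS; apply/coreP; split=> // X cX.
have c0 (S' : {set V}) : inner E S' \subset G h -> e \notin inner E S' -> cut (inner E S') X = set0.
  move=> sub eS'; apply: cut_eq; first exact: sub0set.
  move=> f fi; rewrite (in_cutE cX) ?(subsetP sub) // !inE.
  by apply: contraNF eS' => /eqP<-.
have hX : crosses h X = false by rewrite (in_cutE cX) // inE (negPf he).
have eX : crosses e X by rewrite (in_cutE cX) // set11.
have cS : X :&: S = set0 \/ S \subset X.
  by apply/Sconn/c0; [apply: inner_pair_sub|apply/negP => /inner_notin_cut; rewrite eS].
have cC : X :&: ~: S = set0 \/ ~: S \subset X.
  apply/Cconn/c0; first exact: inner_pair_subC.
  by apply/negP => /inner_notin_cut; rewrite cutC eS.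
have inX x : x \in X -> (X :&: S = set0 -> x \notin S) /\ (X :&: ~: S = set0 -> x \in S).
  by move=> xX; split=> /setP/(_ x); rewrite !inE xX; case: (x \in S).
have XE : [\/ X = set0, X = setT, X = S | X = ~: S].
  have XC : X :&: ~: S = set0 -> X \subset S.
    by move=> X0; apply/subsetP => x /inX[_]; apply.
  have XS : X :&: S = set0 -> X \subset ~: S.
    by move=> X0; apply/subsetP => x /inX[+ _]; rewrite inE; apply.
  case: cS cC => [/XS X1|X1] [/XC X2|X2].
  - apply: Or41; apply/eqP; rewrite -subset0 -(setICr S); apply/subsetP => x xX.
    by rewrite inE (subsetP X2) ?(subsetP X1).
  - by apply: Or44; apply/eqP; rewrite eqEsubset X1.
  - by apply: Or43; apply/eqP; rewrite eqEsubset X1 X2.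
  - by apply: Or42; apply/eqP; rewrite -subTset -(setUCr S) subUset X1.
have hcS := (cutE_crosses hS).2.
case: XE => E1; move: hX eX; rewrite E1 ?crossesC ?hcS //.
  by rewrite /crosses !setI0 !eqxx.
by rewrite /crosses !setDT !eqxx !andbF.
Qed.

Hypothesis phi0 : forall h, h \in cut E S -> h != e ->
  forall F : {set {set V}}, F \subset G h -> \sum_(f in core F) phi f = 0.
(** A minimal cut with at least three edges contains no 2-cut. *)
Hypothesis cut_cls : forall h y, h \in cut E S -> y \in cut E S -> y \in cls E h -> y = h.

(** The combinatorial condition of the theorem, for both sides at once. *)
Hypothesis bridge_cls : forall b (S' : {set V}), S' = S \/ S' = ~: S ->
  b \in inner E S' -> b \notin core (inner E S') ->
  exists2 h, h \in cut E S & h \in cls E b.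

(** In [G h] the cut shrinks to [{e, h}], which merges the two classes. Any further member [y] is a
    bridge of its side, so it is coparallel in [G] to a cut edge [h']; if [h'] were neither [e] nor
    [h], its absence from [G h] would make [y] a bridge there, against [cls_core]. *)
Lemma cls_pair_sub h : h \in cut E S -> h != e ->
  cls (G h) e = cls E e :|: cls E h.
Proof.
move=> hS he; have [eG hG] := mem_pair_sub hS.
have [hE _] := cutE_crosses hS; have [eE _] := cutE_crosses eS.
have sub := subsetP (pair_sub_sub E (cut E S) e h).
have ec := cut_core hS he.
have hcls : h \in cls (G h) e.
  by apply/clsP; split=> //; right; exists S; apply: cut_pair_sub.
have clsG f y : f \in cut E S -> f \in G h -> y \in cls E f -> y \in cls (G h) f.
  move=> fS fG yf; have [->|yne] := eqVneq y f; first exact: cls_refl.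
  case/clsP: (yf) => yE [E1|[X cX]]; first by rewrite E1 eqxx in yne.
  have yG : y \in G h.
    rewrite inE yE; case: (boolP (y \in cut E S)) => //= yS.
    by have := cut_cls fS yS yf => E1; rewrite E1 eqxx in yne.
  apply/clsP; split=> //; right; exists X; apply: cut_eq.
    by apply/subsetP => z /set2P[]->.
  by move=> z /sub zE; rewrite (in_cutE cX).
apply/setP => y; rewrite in_setU; apply/idP/orP => [yL|[]]; last first.
- by move/(clsG _ _ hS hG); apply: cls_trans.
- exact: clsG.
have [->|ye] := eqVneq y e; first by left; apply: cls_refl.
have [->|yh] := eqVneq y h; first by right; apply: cls_refl.
case/clsP: (yL) => yG [E1|[X cX]]; first by rewrite E1 eqxx in ye.
have yE := sub _ yG.
have yS : y \notin cut E S.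
  by move: yG; rewrite inE yE (negPf ye) (negPf yh) !orbF.
have [S' S'S yi] : exists2 S' : {set V}, S' = S \/ S' = ~: S & y \in inner E S'.
  by case: (notin_cut_inner yE yS) => yi; [exists S|exists (~: S)] => //; [left|right].
have sub' : inner E S' \subset G h.
  by case: S'S => ->; [apply: inner_pair_sub|apply: inner_pair_subC].
have [h' h'S h'y] : exists2 h, h \in cut E S & h \in cls E y.
  apply: (bridge_cls S'S yi); apply/negP => /coreP[_ /(_ X)]; apply.
  apply: cut_eq; first by rewrite sub1set.
  move=> f fi; rewrite (in_cutE cX) ?(subsetP sub') // !inE.
  case: eqP => // fe; have : e \notin inner E S'; last by rewrite -fe fi.
  by apply/negP => /inner_notin_cut; case: S'S => ->; rewrite ?cutC eS.
have [<-|h'e] := eqVneq h' e; first by left; apply: cls_sym.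
have [<-|h'h] := eqVneq h' h; first by right; apply: cls_sym.
have h'n : h' \notin G h.
  by rewrite inE h'S (negPf h'e) (negPf h'h) andbF.
case/clsP: h'y => _ [E1|[Y cY]]; first by rewrite E1 yG in h'n.
case/coreP: (subsetP (cls_core (sG (h:=h)) ec) _ yL) => _ /(_ Y) []; apply: cut_eq.
  by rewrite sub1set.
move=> f fG; rewrite (in_cutE cY) ?sub // !inE.
by case: (eqVneq f h') => [E1|_]; [rewrite -E1 fG in h'n|rewrite orbF].
Qed.

Lemma sum_cut_class h : h \in cut E S -> h != e ->
  \sum_(f in cls E h) phi f = - \sum_(f in cls E e) phi f.
Proof.
move=> hS he; have [hE _] := cutE_crosses hS; have [eE _] := cutE_crosses eS.
have : \sum_(f in cls (G h) e) phi f = 0.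
  by apply: sum_cls0 (cut_core hS he) => // F sF; apply: phi0 sF.
rewrite cls_pair_sub // (big_setID (cls E h)).
have -> : (cls E e :|: cls E h) :&: cls E h = cls E h by apply/setIidPr/subsetUr.
have -> : (cls E e :|: cls E h) :\: cls E h = cls E e.
  rewrite setDUl setDv setU0; apply/setDidPl.
  rewrite -setI_eq0 -subset0; apply/subsetP => y /setIP[ye yh].
  have hy : h \in cls E y by apply: cls_sym.
  by have := cut_cls eS hS (cls_trans sE eE ye hy) => E1; rewrite E1 eqxx in he.
by move/eqP; rewrite addr_eq0 => /eqP.
Qed.

Definition asym f : R := if f == e then 1 else if f \in cut E S then -1 else 0.

(** The left side of the inequality is [2 x_e - x(cut)]. *)
Lemma sum_asym (F : {set {set V}}) : F \subset E ->
  \sum_(f in F) asym f = (e \in F).*2%:R - #|cut F S|%:R.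
Proof.
move=> sF.
have asymE f : asym f = (f == e)%:R * 2 - (f \in cut E S)%:R.
  rewrite /asym; have [->|_] := eqVneq f e; first by rewrite eS mul1r addrK.
  by case: (f \in cut E S); rewrite mul0r ?subr0 ?sub0r.
under eq_bigr do rewrite asymE.
rewrite sumrB; congr (_ - _).
  rewrite -mulr_suml -muln2 natrM; congr (_ * _).
  have [eF|eF] := boolP (e \in F); last first.
    by rewrite big1 // => f fF; case: eqP => // E1; rewrite -E1 fF in eF.
  by rewrite (bigD1 e) //= eqxx big1 ?addr0 // => f /andP[_ /negPf->].
rewrite -natr_sum; congr _%:R; rewrite -sum1_card big_mkcond [RHS]big_mkcond /=.
apply: eq_bigr => f _; rewrite !in_cut; case fF: (f \in F) => //=.
by rewrite (subsetP sF) //=; case: crosses.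
Qed.

(** A bridgeless [F] is a union of classes of [G], so the identity is checked class by class: a
    class with a cut edge [h] has values [lam] and [1] if [h = e], [-lam] and [-1] otherwise; on the
    other classes both sums vanish. *)
Lemma face_functional (F : {set {set V}}) h0 : h0 \in cut E S -> h0 != e ->
  F \subset E -> bridgeless F ->
  \sum_(f in F) phi f = (\sum_(f in cls E e) phi f) * \sum_(f in F) asym f.
Proof.
move=> h0S h0e sF bF; set lam := \sum_(f in cls E e) phi f.
apply/eqP; rewrite -subr_eq0 mulr_sumr -sumrB; apply/eqP.
apply: (sum_closed0 sE sF) => [b bb|b bE]; first exact: bridgeless_closed.
rewrite sumrB -mulr_sumr; have [eE _] := cutE_crosses eS.
have asym1 h : h \in cut E S -> \sum_(f in cls E h) asym f = asym h.
  move=> hS; have [hE _] := cutE_crosses hS.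
  rewrite (bigD1 h) /=; last exact: cls_refl.
  rewrite big1 ?addr0 // => f /andP[fh fne]; rewrite /asym.
  have [fe|_] := eqVneq f e.
    by have := cut_cls hS eS; rewrite -fe => /(_ fh) E1; rewrite E1 eqxx in fne.
  case: ifP => // fS; by rewrite (cut_cls hS fS fh) eqxx in fne.
have [/existsP[h /andP[hS hb]]|none] := boolP [exists h, (h \in cut E S) && (h \in cls E b)].
  have -> : cls E b = cls E h.
    have [hE _] := cutE_crosses hS; have bh := cls_sym bE hb.
    by apply/setP => x; apply/idP/idP; apply: cls_trans.
  rewrite asym1 // /asym hS; have [->|he] := eqVneq h e; first by rewrite mulr1 subrr.
  by rewrite sum_cut_class // -/lam; lra.
have Kn y : y \in cls E b -> y \notin cut E S.
  by move=> yb; apply: contra none => yS; apply/existsP; exists y; rewrite yS.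
rewrite [X in _ - _ * X]big1; last first.
  move=> f /Kn fS; rewrite /asym (negPf fS); case: eqP => // fe.
  by rewrite fe eS in fS.
rewrite mulr0 subr0.
have incore (S' : {set V}) : S' = S \/ S' = ~: S -> b \in inner E S' -> b \in core (inner E S').
  move=> S'S bi; apply: contraT => bn; have [h hS hb] := bridge_cls S'S bi bn.
  by have := Kn h hb; rewrite hS.
have [bi|bi] := notin_cut_inner bE (Kn b (cls_refl bE)).
  by apply: (sum_inner_class0 sE Sconn Cconn eS phi0 h0S h0e) => //; apply: incore => //; left.
apply: (@sum_inner_class0 R V E sE (~: S) e phi Cconn _ _ _ b h0); rewrite ?setCK ?cutC //.
by apply: incore => //; right.
Qed.

End FaceFunctionalValue.

(** * Validity of the inequality, and necessity of the bridge condition *)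

Section Necessity.
Variables (R : realFieldType) (V : finType) (E : {set {set V}}).
Hypotheses (sE : simple E) (bE : bridgeless E).
Variables (S e : {set V}).
Hypothesis eS : e \in cut E S.

(** A positive value forces [e] to be the only edge of [F] in the cut, hence a bridge of [F]. *)
Lemma asym_le0 (F : {set {set V}}) : F \subset E -> bridgeless F ->
  \sum_(f in F) asym R E S e f <= 0.
Proof.
move=> sF bF; rewrite sum_asym // subr_le0 ler_nat.
have [eF|//] := boolP (e \in F); rewrite leqNgt; apply/negP => lt2.
have e_cut : e \in cut F S by rewrite in_cut eF (cutE_crosses eS).2.
have := forallP bF S; rewrite eqn_leq -ltnS lt2 /= => /negP[].
by apply/card_gt0P; exists e.
Qed.

(** Suppose the class of [b] misses the cut. The functional [c], equal to 1 at [b] and -1 on the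
    other edges crossing the side [X] of [b], vanishes on the face, so some [c - lam * asym]
    vanishes on all bridgeless sets and thus on the class of [b]; but there only [b] contributes,
    with value 1. *)
Lemma facet_bridge_cls (S' b : {set V}) : S' = S \/ S' = ~: S ->
  (forall c : {set V} -> R,
    (forall F : {set {set V}}, F \subset E -> bridgeless F -> conn F ->
       \sum_(f in F) asym R E S e f = 0 -> \sum_(f in F) c f = 0) ->
    exists lam, forall F : {set {set V}}, F \subset E -> bridgeless F -> conn F ->
       \sum_(f in F) c f = lam * \sum_(f in F) asym R E S e f) ->
  b \in inner E S' -> b \notin core (inner E S') ->
  exists2 h, h \in cut E S & h \in cls E b.
Proof.
move=> S'S crit bi bn.
have cutS' : cut E S' = cut E S by case: S'S => ->; rewrite ?cutC.
have bIE : b \in E by apply: (subsetP (inner_sub E S')).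
have [eE _] := cutE_crosses eS.
have bS : b \notin cut E S by rewrite -cutS' inner_notin_cut.
have [/existsP[h /andP[hS hb]]|none] := boolP [exists h, (h \in cut E S) && (h \in cls E b)].
  by exists h.
exfalso.
have Kn y : y \in cls E b -> y \notin cut E S.
  by move=> yb; apply: contra none => yS; apply/existsP; exists y; rewrite yS.
have [X0 cX0] := notcoreP bi bn.
have crI f (X : {set V}) : f \in inner E S' -> crosses f (X :&: S') = crosses f X.
  case/setIdP => _ fS; rewrite /crosses setIA setIAC (setIidPl fS).
  congr (_ && (_ != _)); apply/setP => x; rewrite !inE.
  by case xf: (x \in f); rewrite ?andbF // (subsetP fS) ?andbT.
(* A side of [b] that meets [e] is replaced by its complement in [S']. *)
have [X [XS eX cX]] : exists X : {set V},
    [/\ X \subset S', ~~ crosses e X & cut (inner E S') X = [set b]].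
  have cX1 : cut (inner E S') (X0 :&: S') = [set b].
    by rewrite -cX0; apply/setP => f; rewrite !in_cut; case fi: (f \in _); rewrite //= crI.
  have [eX|eX] := boolP (crosses e (X0 :&: S')); last first.
    by exists (X0 :&: S'); rewrite subsetIr.
  exists (symd (X0 :&: S') S'); split.
  - by apply/subsetP => x; rewrite !inE; case: (x \in S'); rewrite ?andbF ?andbT.
  - rewrite crosses_symd ?sE // eX; move: eS; rewrite -cutS' in_cut => /andP[_ ->].
    by [].
  - rewrite cut_symd; last exact: simpleS (inner_sub E S') sE.
    rewrite cX1; apply/setP => f; rewrite [LHS]in_set.
    suff -> : cut (inner E S') S' = set0 by rewrite in_set0 addbF.
    apply/eqP; rewrite -subset0; apply/subsetP => z; rewrite in_cut => /andP[zF zS].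
    by have := inner_notin_cut zF; rewrite in_cut zS (subsetP (inner_sub E S')).
have bX : crosses b X by rewrite (in_cutE cX) // set11.
have crossX f : f \in E -> f \notin cut E S -> crosses f X = (f == b).
  move=> fE fS; rewrite -cutS' in fS; have [fi|fi] := notin_cut_inner fE fS.
    by rewrite (in_cutE cX) // inE.
  rewrite (negPf (inner_crosses_sub XS fi)); apply/esym/negbTE.
  by apply: contraTneq fi => ->; apply: inner_disj.
pose c f : R := if f == b then 1 else if crosses f X then -1 else 0.
have cface (F : {set {set V}}) : F \subset E -> bridgeless F -> conn F ->
    \sum_(f in F) asym R E S e f = 0 -> \sum_(f in F) c f = 0.
  (* Equality means that [F] misses the cut or contains exactly [e] and one further cut edge [h]. *)
  move=> sF bF _; rewrite sum_asym // => /eqP; rewrite subr_eq0 eqr_nat => /eqP F2.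
  have cutFX : cut F X \subset b |: (cut F S :\ e).
    apply/subsetP => f; rewrite in_cut => /andP[fF fX]; rewrite !in_setU1 in_setD1.
    have fE := subsetP sF f fF.
    have [//|fb] := eqVneq f b; rewrite in_cut fF /=; apply/andP; split.
      by apply: contraTneq fX => ->.
    by apply: contraTT fX => fS; rewrite crossX ?fb // in_cut fE.
  have [eF|eF] := boolP (e \in F); last first.
    have F0 : cut F S = set0 by apply/eqP; rewrite -cards_eq0 -F2 (negPf eF).
    have FX0 : cut F X = set0.
      move: cutFX; rewrite F0 set0D setU0 subset1 => /orP[/eqP|/eqP//].
      by move/bridgelessP => /(_ bF).
    rewrite big1 // => f fF; have : f \notin cut F X by rewrite FX0 inE.
    rewrite in_cut fF /= /c => fX; rewrite (negPf fX).
    by case: eqP => // fb; rewrite fb bX in fX.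
  have e_cut : e \in cut F S by rewrite in_cut eF (cutE_crosses eS).2.
  have [h hE] : exists h, cut F S :\ e = [set h].
    apply/cards1P; have := cardsD1 e (cut F S); rewrite e_cut -F2 eF.
    by move/eqP; rewrite eqSS eq_sym.
  have hF : h \in F.
    have : h \in cut F S :\ e by rewrite hE set11.
    by rewrite in_setD1 in_cut => /and3P[].
  have hS : h \in cut E S.
    have : h \in cut F S :\ e by rewrite hE set11.
    by rewrite in_setD1 !in_cut (subsetP sF _ hF) => /and3P[].
  have bh : b != h by apply: contraNneq bS => ->.
  (* The cut of [X] in [F] lies in [{b, h}]; being no single edge it is empty or the whole pair, and
     [c] sums to zero either way. *)
  rewrite hE in cutFX.
  have [FX0|FX0] := eqVneq (cut F X) set0.
    rewrite big1 // => f fF; have : f \notin cut F X by rewrite FX0 inE.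
    rewrite in_cut fF /= /c => fX; rewrite (negPf fX).
    by case: eqP => // fb; rewrite fb bX in fX.
  have FXE : cut F X = [set b; h].
    apply/eqP; rewrite eqEsubset cutFX /=; apply/subsetP => z zbh.
    (* [z'] is the element of [{b, h}] other than [z]. *)
    apply: contraT => zn; pose z' := if z == b then h else b.
    case: (@bridgelessP _ F X z' bF); apply/eqP.
    have : cut F X \subset [set z'].
      apply/subsetP => y yX; have := subsetP cutFX y yX; rewrite !inE /z'.
      have yz : y != z by apply: contraNneq zn => <-.
      move: zbh yz; rewrite !inE => /orP[]/eqP->; rewrite ?eqxx.
        by move/negPf->.
      by rewrite (eq_sym h) (negPf bh) => /negPf->; rewrite orbF.
    by rewrite subset1 (negPf FX0) orbF.
  have bF' : b \in F by have : b \in cut F X; [rewrite FXE set21|rewrite in_cut => /andP[]].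
  have hX : crosses h X by have : h \in cut F X; [rewrite FXE set22|rewrite in_cut => /andP[]].
  rewrite (bigD1 b) //= (bigD1 h) /=; last by rewrite hF eq_sym.
  rewrite /c eqxx [h == b]eq_sym (negPf bh) hX big1 ?addr0 ?subrr // => f.
  case/andP=> /andP[fF fb] fh; rewrite (negPf fb).
  suff -> : crosses f X = false by [].
  by rewrite (in_cutE FXE) // mem_pair (negPf fb) (negPf fh).
have [lam lamE] := crit c cface.
pose psi f := c f - lam * asym R E S e f.
have psi0 (F : {set {set V}}) : F \subset E -> bridgeless F -> \sum_(f in F) psi f = 0.
  move=> sF; apply: sum_bridgeless; first exact: simpleS sF sE.
  move=> F' sF' bF' cF'; rewrite sumrB -mulr_sumr lamE ?subrr //.
  exact: subset_trans sF' sF.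
have : \sum_(f in cls E b) psi f = 0.
  apply: sum_cls0; rewrite ?bridgeless_core // => F' sF'; apply: psi0.
    exact: subset_trans (core_sub _) sF'.
  exact/core_bridgeless/(simpleS sF').
rewrite (bigD1 b) /=; last exact: cls_refl.
rewrite big1; last first.
  move=> f /andP[fK fb]; have fS := Kn f fK; have fE := subsetP (cls_sub _ _) _ fK.
  rewrite /psi /c /asym (negPf fb) crossX // (negPf fb) (negPf fS).
  by case: eqP => [fe|_]; [rewrite fe eS in fS|rewrite mulr0 subrr].
rewrite /psi /c /asym eqxx (negPf bS); case: eqP => [be|_].
  by rewrite be eS in bS.
by rewrite mulr0 subr0 addr0 => /eqP; rewrite oner_eq0.
Qed.

End Necessity.

(** * Translation between the graph notions of the statement and cuts *)

Section Graph.
Variables (V : finType) (g : rel V).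
Hypothesis g_irr : irreflexive g.
Hypothesis G2ec : two_ec setT (gedges g).
Notation E := (gedges g).

Lemma gedges_simple : simple E.
Proof.
move=> f; rewrite inE => /existsP[u /existsP[v /andP[guv /eqP->]]].
by rewrite cards2; case: eqP guv => // ->; rewrite g_irr.
Qed.

Lemma gedges_graph : is_graph setT E.
Proof. by move=> f fE; split; [apply: subsetT|apply: gedges_simple]. Qed.

Lemma gedges_two_ec : [&& E \subset E, bridgeless E & conn E].
Proof. by apply/(two_ecP _ gedges_simple); exists setT; split=> //; split=> //; apply: gedges_graph. Qed.

Lemma gedges_cut0 X : cut E X = set0 -> X = set0 \/ X = setT.
Proof.
move=> cX; have [->|[u uX]] := set_0Vmem X; [by left|right].
apply/setP => v; rewrite in_setT -uX; apply/esym/(cut0_connect cX).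
by apply: G2ec.1; rewrite inE.
Qed.

Lemma is_cut_cut (X : {set V}) : cut E X != set0 -> is_cut g (cut E X).
Proof.
move=> cX; exists X; split=> //; split; apply: contraNneq cX => ->.
  by apply/eqP/setP => f; rewrite in_cut in_set0 /crosses setI0 eqxx andbF.
by apply/eqP/setP => f; rewrite in_cut in_set0 /crosses setDT eqxx !andbF.
Qed.

(** A cut properly inside [{b, d}] has at most one edge: one is excluded by bridgelessness, none by
    connectivity. *)
Lemma cls_coparallel b d : b \in E -> d \in cls E b -> b != d -> coparallel g b d.
Proof.
move=> bE /clsP[dE [->|[X cX]]]; first by rewrite eqxx.
move=> bd; split=> //; rewrite -cX; split.
  by apply: is_cut_cut; rewrite cX; apply/set0Pn; exists b; rewrite set21.
move=> C' [Y [[Y0 YT] CE]] /proper_card; rewrite [C']CE -/(cut E Y) cX cards2 bd ltnS.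
case/and3P: gedges_two_ec => _ /forallP/(_ Y) + _.
rewrite leq_eqVlt => /negPf->; rewrite /= ltnS leqn0 cards_eq0 => /eqP/gedges_cut0[] YE.
  by rewrite YE eqxx in Y0.
by rewrite YE eqxx in YT.
Qed.

Lemma coparallel_cls b d : d \in E -> coparallel g b d -> d \in cls E b.
Proof.
by move=> dE [_ [[X [_ cX]] _]]; apply/clsP; split=> //; right; exists X.
Qed.

(** [cls E b] is itself a maximal coparallel family, and every coparallel family containing [b] lies
    in it. *)
Lemma copar_classP (S b : {set V}) : b \in E ->
  (exists K f, copar_class g K /\ f \in delta g S /\ b \in K /\ f \in K) <->
  exists2 h, h \in cut E S & h \in cls E b.
Proof.
move=> bE; split=> [[K [f [[[sK [_ cK]] _] [fS [bK fK]]]]]|[h hS hb]].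
  exists f => //; have [->|bf] := eqVneq b f; first by apply/cls_refl/(subsetP sK).
  by apply: coparallel_cls; [apply: (subsetP sK)|apply: cK].
have sE := gedges_simple.
exists (cls E b), h; split; last by split=> //; split=> //; apply: cls_refl.
split=> [|K' [sK' [_ cK']] /properP[sub [y yK' yn]]].
  split; first exact: cls_sub.
  split; first by move=> f _; apply: G2ec.2.
  move=> f d fb db fd; have fE := subsetP (cls_sub _ _) _ fb.
  by apply: cls_coparallel => //; apply: cls_trans db => //; apply: cls_sym.
have yb : b != y by apply: contraNneq yn => <-; apply: cls_refl.
case/negP: yn; apply: coparallel_cls; first exact: (subsetP sK').
by apply: cK' => //; apply: (subsetP sub); apply: cls_refl.
Qed.

Lemma inner_graph S : is_graph S (inner E S).
Proof. by move=> f /setIdP[fE fS]; split=> //; apply: gedges_simple. Qed.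

Lemma bridge_inner S b :
  is_bridge S (induced_edges g S) b <-> b \in inner E S /\ b \notin core (inner E S).
Proof.
rewrite (ncomp_bridge b (inner_graph (S := S))); split=> [[X cX]|[bi /notcoreP]]; last exact.
have : b \in cut (inner E S) X by rewrite cX set11.
rewrite in_cut => /andP[bi _]; split=> //; apply/negP => /coreP[_ /(_ X)].
exact.
Qed.

End Graph.

(** * The facet characterization, assembled from the criterion and both directions *)

Theorem mainTheorem7 (R : realFieldType) (V : finType) (g : rel V)
  (g_sym : symmetric g) (g_irr : irreflexive g)
  (G2ec : two_ec setT (gedges g))
  (S : {set V}) (HS : proper_vset S)
  (Hmin : is_min_cut g (delta g S))
  (H3 : (3 <= #|delta g S|)%N)
  (e : {set V}) (He : e \in delta g S) :
  defines_facet (@TECSP R V g) (@asym_cut_coef R V g S e) 0 <->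
  (forall b, (is_bridge S (induced_edges g S) b \/
              is_bridge (~: S) (induced_edges g (~: S)) b) ->
     exists K f, copar_class g K /\ f \in delta g S /\ b \in K /\ f \in K).
Proof.
have sE := gedges_simple g_irr; set E := gedges g in sE *.
have tE : [&& E \subset E, bridgeless E & conn E] := gedges_two_ec g_irr G2ec.
have bE : bridgeless E by case/and3P: tE.
have eS : e \in cut E S := He.
have card3 : (3 <= #|cut E S|)%N := H3.
have minS (X : {set V}) : X != set0 -> X != setT -> ~ cut E X \proper cut E S.
  by move=> X0 XT; apply: Hmin.2; exists X.
have Sconn : side_conn E S by apply: minimal_cut_side_conn => //; apply: gedges_cut0.
have Cconn : side_conn E (~: S).
  by apply: minimal_cut_side_conn => //; [apply: gedges_cut0|rewrite cutC].
pose Q (F : {set {set V}}) := [&& F \subset E, bridgeless F & conn F].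
have dotE (c : {ffun {set V} -> R}) F : dotv c (chi R F) = \sum_(f in F) c f.
  rewrite /dotv [RHS]big_mkcond; apply: eq_bigr => f _; rewrite ffunE.
  by case: ifP; rewrite ?mulr1 ?mulr0.
have dotA F : dotv (asym_cut_coef R g S e) (chi R F) = \sum_(f in F) asym R E S e f.
  by rewrite dotE; apply: eq_bigr => f _; rewrite ffunE.
have bridgeP b : (is_bridge S (induced_edges g S) b \/
      is_bridge (~: S) (induced_edges g (~: S)) b) <->
    exists2 S', S' = S \/ S' = ~: S & b \in inner E S' /\ b \notin core (inner E S').
  rewrite !(bridge_inner g_irr); split=> [[H|H]|[S' [->|->] H]]; [| |by left|by right].
  - by exists S => //; left.
  - by exists (~: S) => //; right.
(* The empty subgraph supplies the origin. *)
rewrite /TECSP (facet_criterion (Q := Q) (i0 := set0)).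
- split=> [[_ crit] b /bridgeP[S' S'S [bi bn]]|cond].
    have bIE := subsetP (inner_sub E S') b bi.
    apply/(copar_classP g_irr G2ec) => //.
    apply: (facet_bridge_cls sE bE eS S'S _ bi bn) => c cface.
    have [F /and3P[sF bF cF]|lam lamE] := crit [ffun f => c f].
      rewrite dotA dotE => a0; rewrite -[RHS](cface F sF bF cF a0).
      by apply: eq_bigr => f _; rewrite ffunE.
    exists lam => F sF bF cF; rewrite -dotA -lamE ?/Q ?sF ?bF // dotE.
    by apply: eq_bigr => f _; rewrite ffunE.
  have brcls b (S' : {set V}) : S' = S \/ S' = ~: S ->
      b \in inner E S' -> b \notin core (inner E S') ->
      exists2 h, h \in cut E S & h \in cls E b.
    move=> S'S bi bn; have bIE := subsetP (inner_sub E S') b bi.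
    by apply/(copar_classP g_irr G2ec) => //; apply/cond/bridgeP; exists S'.
  have cut_cls h y : h \in cut E S -> y \in cut E S -> y \in cls E h -> y = h.
    move=> hS yS /clsP[_ [//|[X cX]]].
    have cX0 : cut E X != set0 by rewrite cX; apply/set0Pn; exists h; rewrite set21.
    case: (Hmin.2 _ (is_cut_cut cX0)); rewrite cX properEcard cards2.
    apply/andP; split; first by apply/subsetP => z /set2P[]->.
    by apply: leq_trans card3; case: eqP.
  have [h0 h0S h0e] : exists2 h0, h0 \in cut E S & h0 != e.
    have /card_gt0P[h] : (0 < #|cut E S :\ e|)%N.
      by move: card3; rewrite (cardsD1 e) eS; case: #|_|.
    by rewrite in_setD1 => /andP[he hS]; exists h.
  split.
    (* [G] itself is off the face: its value is [2 - |cut E S|], and the cut has at least three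
       edges. *)
    exists E => //; rewrite dotA sum_asym //; case/cutE_crosses: (eS) => -> _.
    by rewrite subr_eq0 eqr_nat; apply: contraTneq card3 => <-.
  (* The multiplier is read off on the class of [e], where [asym] sums to 1. *)
  move=> c cface; exists (\sum_(f in cls E e) c f) => F /and3P[sF bF cF].
  rewrite dotA dotE; apply: (@face_functional R V E sE S e c Sconn Cconn eS _ cut_cls brcls F h0) => //.
  move=> h hS he F' sF'; have sG := pair_sub_sub E (cut E S) e h.
  apply: sum_bridgeless => [||]; last 1 first.
  - by apply: core_bridgeless; apply: simpleS (subset_trans sF' sG) sE.
  - exact: simpleS (subset_trans (core_sub _) (subset_trans sF' sG)) sE.
  move=> F2 sF2 bF2 cF2; have sF2G := subset_trans sF2 (subset_trans (core_sub _) sF').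
  have sF2E := subset_trans sF2G sG.
  rewrite -dotE; apply: cface; first by rewrite /Q sF2E bF2.
  (* Validity gives one inequality; for the other, [F2] has at most two cut edges, and none without
     [e], since [h] alone would be a bridge. *)
  rewrite dotA; apply/eqP; rewrite eq_le asym_le0 //= sum_asym // subr_ge0 ler_nat.
  have sub : cut F2 S \subset [set e; h].
    apply/subsetP => f; rewrite in_cut => /andP[fF fS].
    have := subsetP sF2G f fF; rewrite inE => /andP[fE].
    by rewrite in_cut fE fS /= mem_pair.
  have [eF|eF] := boolP (e \in F2).
    by apply: leq_trans (subset_leq_card sub) _; rewrite cards2; case: eqP.
  have sub1 : cut F2 S \subset [set h].
    apply/subsetP => f fc; have := subsetP sub f fc; rewrite !inE => /orP[/eqP fe|//].
    by move: fc; rewrite in_cut fe (negPf eF).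
  move: sub1; rewrite subset1 => /orP[/eqP/bridgelessP|/eqP->]; first by move/(_ bF2).
  by rewrite cards0.
- move=> F; apply: (iffP idP) => [QF|[W [[gF sF] tF]]].
    by have [W [[gF sF] tF]] := (two_ecP F sE).2 QF; exists W.
  by apply/(two_ecP F sE); exists W.
- rewrite /Q sub0set; have c0 X : cut (set0 : {set {set V}}) X = set0.
    by apply/setP => f; rewrite in_cut !in_set0.
  rewrite /=; apply/andP; split; apply/forallP => X; first by rewrite c0 cards0.
  by rewrite /cover big_set0 sub0set implybT.
- by apply/ffunP => f; rewrite !ffunE in_set0.
- by move=> F /and3P[sF bF _]; rewrite dotA asym_le0.
Qed.
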